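(* Let $0<a_1<a_2<\cdots<a_n$ be task lengths, $A_i:=a_1+\cdots+a_i$, and for $i\le j$, $A_{i:j}:=\sum_{k=i}^j a_k$. For a permutation $\pi$ of $\{1,\dots,n\}$ let $A_{\pi(i)}:=a_{\pi(1)}+\cdots+a_{\pi(i)}$. Let the disruption intensity be $\lambda(t)=\bar\lambda f(t)$ with $\bar\lambda>0$ and $f$ a positive differentiable function on $[0,\infty)$ with $f_-:=\inf_{t\ge0}f(t)>0$ and $f_+:=\sup_{t\ge0}f(t)<\infty$. Assume $\bar\lambda\le \frac{1}{2f_+a_n}$. (i) Suppose $f$ is strictly decreasing on $[0,A_n]$ and that for every permutation $\pi\neq\mathrm{id}$, $$\bar\lambda<\frac{\sum_{i=1}^n a_{\pi(i)}\int_0^{A_{\pi(i)}}f(s)\,ds-\sum_{i=1}^n a_i\int_0^{A_i}f(s)\,ds}{(f_+)^2A_n\sum_{i=1}^n a_i^2+(f_+)^2\frac34(A_n)^3}.$$ Then SPT is optimal: $M_{1:n}(0)<M_{\pi(1):\pi(n)}(0)$ for every permutation $\pi\ne\mathrm{id}$. (ii) Suppose $f$ is strictly increasing on $[0,A_n]$ and that for every permutation $\pi$ with $(\pi(1),\dots,\pi(n))\neq(n,n-1,\dots,1)$, $$\bar\lambda<\frac{\sum_{i=1}^n a_{\pi(i)}\int_0^{A_{\pi(i)}}f(s)\,ds-\sum_{i=1}^n a_{n+1-i}\int_0^{A_{n+1-i:n}}f(s)\,ds}{(f_+)^2A_n\sum_{i=1}^n a_i^2+(f_+)^2\frac34(A_n)^3}.$$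 Then LPT is optimal: $M_{n:1}(0)<M_{\pi(1):\pi(n)}(0)$ for every such permutation $\pi$.
   Context: Model: a single machine processes a finite batch of tasks one at a time in a fixed order. A task of length $c>0$ requires $c$ units of uninterrupted processing. Disruptions occur at the points of a non-homogeneous Poisson process on $[0,\infty)$ with intensity function $\lambda(t)$. If a disruption occurs while a task is being processed, all work on it is lost and that task is restarted from scratch at the disruption time (no repair time); a task is completed once it has been processed for $c$ consecutive time units with no disruption, and the machine then immediately starts the next task. For a permutation $\pi$ of $\{1,\dots,n\}$, $M_{\pi(1):\pi(n)}(t)$ denotes the expected time, measured from $t$, to complete all tasks in the order $a_{\pi(1)},\dots,a_{\pi(n)}$ when processing of $a_{\pi(1)}$ starts at time $t$; $M_{1:n}$ corresponds to the identity (SPT order, increasing lengths) and $M_{n:1}$ to the order $a_n,\dots,a_1$ (LPT order, decreasing lengths). *)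

(* Defs.v *)
From HB Require Import structures.
From mathcomp Require Import all_boot all_order all_algebra all_fingroup.
From mathcomp Require Import all_classical all_reals all_analysis.
Set Implicit Arguments. Unset Strict Implicit. Unset Printing Implicit Defensive.
Import Order.TTheory GRing.Theory Num.Theory.
Local Open Scope classical_set_scope.
Local Open Scope ring_scope.

Section Defs.
Context {R : realType}.

(* Poisson probability mass function with mean m >= 0 (valid also for m = 0). *)
Definition pois (m : R) (k : nat) : R := expR (- m) * m ^+ k / (k`!)%:R.

Definition integ (g : R -> R) (s t : R) : R :=
  Rintegral (@lebesgue_measure R) `[s, t] g.

(* N : Omega -> R -> nat, N w t = number of disruptions in (0, t] on the
   sample path w.  [is_NHPP P lam N]: N is a (simple, cadlag-path) counting
   process which is a non-homogeneous Poisson process with intensity lam,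
   i.e. its finite-dimensional laws are those of independent Poisson
   increments with means int_{t_j}^{t_{j+1}} lam. *)
Definition is_NHPP d (Omega : measurableType d) (P : probability Omega R)
    (lam : R -> R) (N : Omega -> R -> nat) : Prop :=
  [/\ (forall w, N w 0 = 0%N),
      (forall w s t, 0 <= s -> s <= t -> (N w s <= N w t)%N),
      (forall w t, 0 <= t -> exists2 e : R, 0 < e &
          forall u, t <= u -> u < t + e -> N w u = N w t) &
      (forall (m : nat) (tt : nat -> R) (k : nat -> nat),
          tt 0%N = 0 -> (forall j, (j < m)%N -> tt j <= tt j.+1) ->
          measurable [set w | forall j, (j < m)%N ->
                               (N w (tt j.+1) - N w (tt j))%N = k j] /\
          P [set w | forall j, (j < m)%N ->
                               (N w (tt j.+1) - N w (tt j))%N = k j]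
          = (\prod_(j < m) pois (integ lam (tt j) (tt j.+1)) (k j))%:E)].

(* Completion time of a task of length c started at time t on the path n:
   the first time u >= t + c such that no disruption occurred in (u - c, u]
   (work is lost at each disruption and restarted). *)
Definition finish1 (n : R -> nat) (c t : R) : R :=
  inf [set u | t + c <= u /\ n u = n (u - c)].

Definition finish (n : R -> nat) (cs : seq R) (t : R) : R :=
  foldl (fun s c => finish1 n c s) t cs.

Definition Mexp d (Omega : measurableType d) (P : probability Omega R)
    (N : Omega -> R -> nat) (cs : seq R) (t : R) : \bar R :=
  (\int[P]_w ((finish (N w) cs t - t)%:E))%E.

Definition order_seq n (a : 'I_n -> R) (pi : {perm 'I_n}) : seq R :=
  [seq a (pi i) | i <- enum 'I_n].

Definition Apref n (a : 'I_n -> R) (pi : {perm 'I_n}) (i : 'I_n) : R :=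
  \sum_(j < n | (j <= i)%N) a (pi j).

End Defs.

(* Main.v *)
Require Import Defs.
From HB Require Import structures.
From mathcomp Require Import all_boot all_order all_algebra all_fingroup.
From mathcomp Require Import all_classical all_reals all_analysis.
From mathcomp Require Import measurable_realfun.
From mathcomp Require Import ring lra.
Set Implicit Arguments.
Unset Strict Implicit.
Unset Printing Implicit Defensive.
Import Order.TTheory GRing.Theory Num.Theory.
Import numFieldNormedType.Exports.
Local Open Scope classical_set_scope.
Local Open Scope ring_scope.

(* Write rho = lbar * fplus, lam = lbar * f and consider the tasks in a fixed
   order.  Up to an error of order rho^2, the expected completion time is the
   total length plus the expected waste caused by the first disruption, and to
   first order in lam that waste is the sum over the tasks of the integrals of
   (s - T_i) lam(s) ds over their nominal slots [T_i, T_i + c_i].  By parts this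
   equals sum_i c_i Lam(T_i + c_i) minus the integral of Lam over [0, A], where
   only the sum depends on the order; so the orders are compared through S, and
   D is what the two second-order errors can amount to.

   Lower bound: a first disruption at s in the i-th slot costs at least s - T_i.
   Upper bound: after it, each remaining task of length c is only allowed to
   finish in one of the consecutive blocks of length c, which takes c e^(rho c)
   on average; rho c <= 1/2 gives e^(rho c) <= 1 + 7/5 rho c.
   In both bounds the first disruption is located only up to a grid of m cells
   per slot, so that finitely many increments of N between deterministic times
   are involved, and m tends to infinity at the end. *)

(** * Integrals of functions continuous on the half-line *)

Section Integrals.
Context {R : realType}.
Implicit Types (g h : R -> R) (s t u : R).

Definition cont_ge0 g := forall x : R, 0 <= x -> {for x, continuous g}.

Lemma cont_ge0_integrable g s t : cont_ge0 g -> 0 <= s ->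
  (@lebesgue_measure R).-integrable `[s, t] (EFin \o g).
Proof.
move=> cg s0; apply: continuous_compact_integrable; first exact: segment_compact.
apply: continuous_in_subspaceT => x; rewrite inE/= in_itv/= => /andP[sx _].
by apply: cg; exact: le_trans sx.
Qed.

Lemma cont_ge0M g h : cont_ge0 g -> cont_ge0 h -> cont_ge0 (fun x => g x * h x).
Proof. by move=> cg ch x x0; apply: continuousM; [exact: cg|exact: ch]. Qed.

Lemma cont_ge0_id : cont_ge0 id.
Proof. by move=> x _; exact: cvg_id. Qed.

Lemma cont_ge0_cst (k : R) : cont_ge0 (fun=> k).
Proof. by move=> x _; exact: cvg_cst. Qed.

Lemma cont_ge0Z (k : R) g : cont_ge0 g -> cont_ge0 (fun x => k * g x).
Proof.
by move=> cg x x0; apply: (@continuousM R R (fun=> k) g); [exact: cvg_cst|exact: cg].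
Qed.

Lemma integ_cat g s t u : cont_ge0 g -> 0 <= s -> s <= t -> t <= u ->
  integ g s u = integ g s t + integ g t u.
Proof.
move=> cg s0 st tu; rewrite /integ.
have := @Rintegral_itvB R g (BLeft s) (BRight u) t (cont_ge0_integrable u cg s0).
rewrite !bnd_simp => /(_ st tu).
rewrite Rintegral_itv_obnd_cbnd.
  by move=> <-; rewrite addrC subrK.
apply: integrableS (cont_ge0_integrable u cg (le_trans s0 st)) => //=.
by apply: subset_itvr; rewrite bnd_simp.
Qed.

Lemma le_integ g h s t : cont_ge0 g -> cont_ge0 h -> 0 <= s ->
  (forall x, s <= x -> x <= t -> g x <= h x) -> integ g s t <= integ h s t.
Proof.
move=> cg ch s0 gh; apply: le_Rintegral => //; try exact: cont_ge0_integrable.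
by move=> x /=; rewrite in_itv/= => /andP[]; exact: gh.
Qed.

Lemma integ_cst (k : R) s t : s <= t -> integ (fun=> k) s t = k * (t - s).
Proof.
move=> st; rewrite /integ Rintegral_cst//=.
rewrite lebesgue_measure_itv/= lte_fin.
by move: st; rewrite le_eqVlt => /predU1P[->|->//]; rewrite ltxx subrr.
Qed.

Lemma integZl (k : R) g s t : cont_ge0 g -> 0 <= s ->
  integ (fun x => k * g x) s t = k * integ g s t.
Proof. by move=> cg s0; rewrite /integ RintegralZl//; exact: cont_ge0_integrable. Qed.

Lemma integ_id g s : integ g s s = 0.
Proof.
by rewrite /integ set_itv1 Rintegral_set1.
Qed.

End Integrals.

(** * First moments of a bounded rate and their Riemann sums *)

Section Rate.
Context {R : realType} (lam : R -> R) (rho : R).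
Hypothesis clam : cont_ge0 lam.
Hypothesis lam0 : forall x : R, 0 <= x -> 0 <= lam x.
Hypothesis lamr : forall x : R, 0 <= x -> lam x <= rho.
Implicit Types s t x y : R.

Lemma rate_ge0 : 0 <= rho.
Proof. exact: le_trans (lam0 (lexx 0)) (lamr (lexx 0)). Qed.

Lemma integ_rate_ge0 s t : 0 <= s -> 0 <= integ lam s t.
Proof.
move=> s0; apply: Rintegral_ge0 => x /=; rewrite in_itv/= => /andP[sx _].
by apply: lam0; exact: le_trans sx.
Qed.

Lemma integ_rate_le s t : 0 <= s -> s <= t -> integ lam s t <= rho * (t - s).
Proof.
move=> s0 st; rewrite -integ_cst//; apply: le_integ => // [|x sx _].
  exact: cont_ge0_cst.
by apply: lamr; exact: le_trans sx.
Qed.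

(** The integral of [(x - s) * lam x] over [[s, t]]: to first order, the expected work lost by an
    attempt that starts at [s] and should end at [t]. *)
Definition moment s t := integ (fun x => x * lam x) s t - s * integ lam s t.

Let cxlam : cont_ge0 (fun x => x * lam x).
Proof. exact: (cont_ge0M (@cont_ge0_id R) clam). Qed.

Lemma moment_cat s t u : 0 <= s -> s <= t -> t <= u ->
  moment s u = moment s t + (moment t u + (t - s) * integ lam t u).
Proof.
move=> s0 st tu; rewrite /moment (integ_cat clam s0 st tu).
by rewrite (integ_cat cxlam s0 st tu); ring.
Qed.

Lemma moment_ge0 s t : 0 <= s -> 0 <= moment s t.
Proof.
move=> s0; rewrite subr_ge0 -integZl//.
apply: le_integ => // [|x sx _].
  exact: cont_ge0Z.
by rewrite ler_wpM2r// lam0//; exact: le_trans sx.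
Qed.

Lemma moment_le s t : 0 <= s -> moment s t <= (t - s) * integ lam s t.
Proof.
move=> s0; rewrite mulrBl lerD2r -integZl//.
apply: le_integ => // [|x sx xt].
  exact: cont_ge0Z.
by rewrite ler_wpM2r// lam0//; exact: le_trans sx.
Qed.

Lemma integ_grid s e k : 0 <= s -> 0 <= e ->
  integ lam s (s + e * k.+1%:R) =
  integ lam s (s + e * k%:R) + integ lam (s + e * k%:R) (s + e * k.+1%:R).
Proof.
move=> s0 e0; apply: integ_cat => //; first by rewrite lerDl mulr_ge0.
by rewrite lerD2l ler_wpM2l// ler_nat.
Qed.

Lemma sum_integ_grid s e k : 0 <= s -> 0 <= e ->
  \sum_(j < k) integ lam (s + e * j%:R) (s + e * j.+1%:R)
  = integ lam s (s + e * k%:R).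
Proof.
move=> s0 e0; elim: k => [|k ih]; first by rewrite big_ord0 mulr0 addr0 integ_id.
by rewrite big_ord_recr/= ih -integ_grid.
Qed.

(** On the [j]-th cell [x - s] lies between [e * j] and [e * j.+1], so the left and right sums miss
    the moment by at most [e] times the total mass. *)
Lemma grid_moment s e k : 0 <= s -> 0 <= e ->
  moment s (s + e * k%:R) - e * integ lam s (s + e * k%:R) <=
    \sum_(j < k) integ lam (s + e * j%:R) (s + e * j.+1%:R) * (e * j%:R)
  /\ \sum_(j < k) integ lam (s + e * j%:R) (s + e * j.+1%:R) * (e * j.+1%:R)
    <= moment s (s + e * k%:R) + e * integ lam s (s + e * k%:R).
Proof.
move=> s0 e0.
(* The left sums are bounded on both sides by induction; the right sums exceed them by exactly [e]
   times the total mass. *)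
have key : moment s (s + e * k%:R) - e * integ lam s (s + e * k%:R) <=
    \sum_(j < k) integ lam (s + e * j%:R) (s + e * j.+1%:R) * (e * j%:R) <=
    moment s (s + e * k%:R).
  elim: k => [|k /andP[ih1 ih2]].
    rewrite big_ord0 mulr0 addr0 integ_id mulr0 subr0.
    by rewrite /moment !integ_id mulr0 subrr lexx.
  have ek : s <= s + e * k%:R by rewrite lerDl mulr_ge0.
  have ekS : s + e * k%:R <= s + e * k.+1%:R.
    by rewrite lerD2l ler_wpM2l// ler_nat.
  rewrite big_ord_recr/= integ_grid// (moment_cat s0 ek ekS).
  set t := s + e * k%:R in ek ekS ih1 ih2 *; set u := s + e * k.+1%:R in ekS *.
  have m0 := moment_ge0 u (le_trans s0 ek).
  have m1 := moment_le u (le_trans s0 ek).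
  have tu : u - t = e by rewrite /u /t -[k.+1]addn1 natrD; ring.
  have ts : t - s = e * k%:R by rewrite /t; ring.
  rewrite tu in m1; rewrite ts.
  by apply/andP; split; lra.
split; first by case/andP: key.
have -> : \sum_(j < k) integ lam (s + e * j%:R) (s + e * j.+1%:R) * (e * j.+1%:R) =
  \sum_(j < k) integ lam (s + e * j%:R) (s + e * j.+1%:R) * (e * j%:R)
   + e * integ lam s (s + e * k%:R).
  rewrite -sum_integ_grid// mulr_sumr -big_split/=; apply: eq_bigr => j _.
  by rewrite -[j.+1]addn1 natrD; ring.
by case/andP: key => _ ?; rewrite lerD2r.
Qed.

End Rate.

(** * Power sums of the task lengths and the second-order error budget *)

Section ListSums.
Context {R : realType}.
Implicit Types (c t : R) (cs : seq R).

Definition len cs := \sum_(c <- cs) c.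
Definition sq cs := \sum_(c <- cs) c ^+ 2.
Definition cube cs := \sum_(c <- cs) c ^+ 3.

(** The sum of [c_i * c_j ^+ 2] over [i <= j]: a disruption in slot [i] has probability at most
    [rho * c_i], and then each task [j >= i] is charged an excess of order [rho * c_j ^+ 2]. *)
Fixpoint tailsq cs := if cs is c :: cs' then c * sq cs + tailsq cs' else 0.

(** Second-order deficit of the lower bound: [c ^+ 3 / 3] comes from cell probabilities falling
    short of the integrated rate, [c * sq cs' / 2] from ignoring later waste once the first slot is
    disrupted. *)
Fixpoint losserr cs :=
  if cs is c :: cs' then c ^+ 3 / 3 + c * sq cs' / 2 + losserr cs' else 0.

Fixpoint prefsum (Lam : R -> R) cs t :=
  if cs is c :: cs' then c * Lam (t + c) + prefsum Lam cs' (t + c) else 0.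

Fixpoint waste1 lam cs t :=
  if cs is c :: cs' then moment lam t (t + c) + waste1 lam cs' (t + c) else 0.

Lemma len_cons c cs : len (c :: cs) = c + len cs.
Proof. exact: big_cons. Qed.
Lemma sq_cons c cs : sq (c :: cs) = c ^+ 2 + sq cs.
Proof. exact: big_cons. Qed.
Lemma cube_cons c cs : cube (c :: cs) = c ^+ 3 + cube cs.
Proof. exact: big_cons. Qed.

Definition pos cs := {in cs, forall c, 0 < c}.

Lemma pos_cons c cs : pos (c :: cs) -> 0 < c /\ pos cs.
Proof.
move=> p; split; first by apply: p; rewrite mem_head.
by move=> x xcs; apply: p; rewrite in_cons xcs orbT.
Qed.

Lemma len_ge0 cs : pos cs -> 0 <= len cs.
Proof. by move=> p; rewrite /len big_seq; apply: sumr_ge0 => c /p /ltW. Qed.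

Lemma sq_ge0 cs : 0 <= sq cs.
Proof. by apply: sumr_ge0 => c _; exact: sqr_ge0. Qed.

Lemma sq_le cs : pos cs -> sq cs <= len cs ^+ 2.
Proof.
elim: cs => [_|c cs ih /pos_cons[c0 p]]; first by rewrite /sq /len !big_nil expr0n.
rewrite sq_cons len_cons; have := ih p; have := mulr_ge0 (ltW c0) (len_ge0 p); lra.
Qed.

(** The difference of the two sides is the sum of [c * (c - len cs) ^+ 2]. *)
Lemma cube_ge cs : pos cs -> 2 * len cs * sq cs - len cs ^+ 3 <= cube cs.
Proof.
move=> p; rewrite -subr_ge0.
have -> : cube cs - (2 * len cs * sq cs - len cs ^+ 3) =
    \sum_(c <- cs) (c * (c - len cs) ^+ 2).
  transitivity (\sum_(c <- cs) (c ^+ 3 - 2 * len cs * c ^+ 2 + len cs ^+ 2 * c)).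
    rewrite big_split/= sumrB -!mulr_sumr -/(cube cs) -/(sq cs) -/(len cs); ring.
  by apply: eq_bigr => c _; ring.
by rewrite big_seq; apply: sumr_ge0 => c /p c0; rewrite mulr_ge0 ?sqr_ge0 ?ltW.
Qed.

Lemma tailsq_le cs : pos cs -> tailsq cs <= len cs * sq cs.
Proof.
elim: cs => [_|c cs ih /pos_cons[c0 p]]; first by rewrite /= /len big_nil mul0r.
rewrite /= sq_cons len_cons; have := ih p; have := mulr_ge0 (len_ge0 p) (sqr_ge0 c); lra.
Qed.

(** The right side is [cube cs / 3] plus half the sum of [c_i * c_j ^+ 2] over all [i <> j];
    [losserr] keeps only the pairs [i < j] of that sum. *)
Lemma losserr_le cs : pos cs -> losserr cs <= len cs * sq cs / 2 - cube cs / 6.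
Proof.
elim: cs => [_|c cs ih /pos_cons[c0 p]].
  by rewrite /= /len /sq /cube !big_nil !mul0r subrr.
rewrite /= sq_cons len_cons cube_cons.
have := ih p; have := mulr_ge0 (len_ge0 p) (sqr_ge0 c).
lra.
Qed.

(** The two lists are the two orders to be compared. With [L = len cs] and [Q = sq cs], the
    preceding bounds leave [47 / 30 * L * Q + L ^+ 3 / 6]; by [Q <= L ^+ 2] the excess
    [17 / 30 * L * Q] becomes cubic, and [17 / 30 + 1 / 6 = 11 / 15 <= 3 / 4]. *)
Lemma budget cs cs' : pos cs -> len cs = len cs' -> sq cs = sq cs' ->
  cube cs = cube cs' -> pos cs' ->
  7 / 5 * tailsq cs + losserr cs' <= len cs * sq cs + 3 / 4 * len cs ^+ 3.
Proof.
move=> p el es ec p'.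
have := tailsq_le p; have := losserr_le p'; rewrite -el -es -ec.
have := cube_ge p; have := ler_wpM2l (len_ge0 p) (sq_le p).
have -> : len cs * len cs ^+ 2 = len cs ^+ 3 by ring.
have : 0 <= len cs * sq cs by rewrite mulr_ge0 ?len_ge0 ?sq_ge0.
lra.
Qed.

Lemma sum_consec k : \sum_(j < k) (j%:R * j.+1%:R : R) <= k%:R ^+ 3 / 3.
Proof.
suff -> : \sum_(j < k) (j%:R * j.+1%:R : R) = (k%:R ^+ 3 - k%:R) / 3.
  by have := ler0n R k; lra.
elim: k => [|k ih]; first by rewrite big_ord0; ring.
by rewrite big_ord_recr/= ih -[k.+1]addn1 natrD; field.
Qed.

(** Bounding [expR (- x)] below by [(1 - x / 8) ^+ 8] makes the claim polynomial. The slope [7 / 5]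
    lies above that of the chord of the exponential on [[0, 1 / 2]], about 1.297, and below
    [17 / 12], up to which the computation in [budget] works. *)
Lemma expR_le_affine (x : R) : 0 <= x -> x <= 1 / 2 -> expR x <= 1 + 7 / 5 * x.
Proof.
move=> x0 x1.
have E8 : expR (- x) = expR (- (x / 8)) ^+ 8.
  by rewrite -expRM_natl; congr expR; field.
have h : (1 - x / 8) ^+ 8 <= expR (- x).
  by rewrite E8 lerXn2r ?nnegrE ?expR_ge0//; [lra|have := expR_ge1Dx (- (x / 8)); lra].
have h2 : 1 <= (1 + 7 / 5 * x) * (1 - x / 8) ^+ 8.
  have -> : x = 8 * (x / 8) by field.
  set y := x / 8; have y0 : 0 <= y by rewrite /y; lra.
  have y1 : y <= 1 / 16 by rewrite /y; lra.
  have -> : 8 * y / 8 = y by field.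
  (* Stopping the eighth power after its cubic term drops a nonnegative remainder. *)
  have b : 1 - 8 * y + 28 * y ^+ 2 - 56 * y ^+ 3 <= (1 - y) ^+ 8.
    have -> : (1 - y) ^+ 8 = 1 - 8 * y + 28 * y ^+ 2 - 56 * y ^+ 3
      + (y ^+ 2) ^+ 2 * (70 - 56 * y + y ^+ 2 * (28 - 8 * y + y ^+ 2)) by ring.
    rewrite lerDl; apply: mulr_ge0; first exact: sqr_ge0.
    apply: addr_ge0; first lra.
    by apply: mulr_ge0; [exact: sqr_ge0|have := sqr_ge0 y; lra].
  apply: (@le_trans _ _ ((1 + 7 / 5 * (8 * y)) * (1 - 8 * y + 28 * y ^+ 2 - 56 * y ^+ 3))).
    rewrite -subr_ge0.
    have -> : (1 + 7 / 5 * (8 * y)) * (1 - 8 * y + 28 * y ^+ 2 - 56 * y ^+ 3) - 1 =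
      y * ((16 / 5 - 308 / 5 * y) + 1288 / 5 * y ^+ 2 - 3136 / 5 * y ^+ 3) by field.
    apply: mulr_ge0; first exact: y0.
    (* The quadratic coefficient is split so that the last factor vanishes exactly at the endpoint
       [y = 1 / 16]. *)
    have -> : 16 / 5 - 308 / 5 * y + 1288 / 5 * y ^+ 2 - 3136 / 5 * y ^+ 3 =
      (16 / 5 - 308 / 5 * y + 1092 / 5 * y ^+ 2) + y ^+ 2 * (196 / 5 - 3136 / 5 * y) by field.
    by apply: addr_ge0; [have := sqr_ge0 (y - 1 / 16); lra|apply: mulr_ge0; [exact: sqr_ge0|lra]].
  by apply: ler_wpM2l b; lra.
have e0 := expR_gt0 x.
have : 1 <= (1 + 7 / 5 * x) * expR (- x).
  by apply: (le_trans h2); apply: ler_wpM2l h; lra.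
by rewrite expRN ler_pdivlMr// mul1r => ?.
Qed.

End ListSums.

(** Each slot contributes an increment of [X] minus its start time multiplied by an increment of
    [Lam]. Summation by parts leaves [prefsum] and boundary terms, and the latter see the tasks
    through their total length alone. *)
Lemma waste1E {R : realType} (lam : R -> R) cs t : cont_ge0 lam -> pos cs -> 0 <= t ->
  let Lam x := integ lam 0 x in
  let X x := integ (fun y => y * lam y) 0 x in
  waste1 lam cs t = X (t + len cs) - X t - (t + len cs) * Lam (t + len cs)
     + t * Lam t + prefsum Lam cs t.
Proof.
move=> clam + + Lam X; elim: cs t => [|c cs ih] t /=.
  by move=> _ _; rewrite /len big_nil !addr0 !subrr; ring.
move=> /pos_cons[c0 p] t0.
have ct : 0 <= t + c by apply: addr_ge0 => //; exact: ltW.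
rewrite (ih (t + c))// len_cons (addrA t c) /moment.
have tc : t <= t + c by rewrite lerDl ltW.
have cx : cont_ge0 (fun y => y * lam y) := cont_ge0M (@cont_ge0_id R) clam.
have e1 : integ lam t (t + c) = Lam (t + c) - Lam t.
  by rewrite /Lam (integ_cat clam (lexx 0) t0 tc); ring.
have e2 : integ (fun y => y * lam y) t (t + c) = X (t + c) - X t.
  by rewrite /X (integ_cat cx (lexx 0) t0 tc); ring.
by rewrite e1 e2; ring.
Qed.

(** * Completion times on one sample path *)

Section Path.
Context {R : realType} (n : R -> nat).
Hypothesis n_nd : forall s t : R, 0 <= s -> s <= t -> (n s <= n t)%N.
Implicit Types (c s t u x y : R) (cs : seq R).

(** Nonemptiness of the set whose infimum is [finish1]; otherwise the infimum takes the default
    value 0 and lower bounds on [finish1] can fail. *)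
Definition completes c t := exists u, t + c <= u /\ n u = n (u - c).

Lemma finish1_ge c t : completes c t -> t + c <= finish1 n c t.
Proof. by move=> [u Su]; apply: lb_le_inf; [exists u|move=> v []]. Qed.

Lemma finish1_le c t u : t + c <= u -> n u = n (u - c) -> finish1 n c t <= u.
Proof. by move=> tu nu; apply: ge_inf => //; exists (t + c) => v []. Qed.

Lemma finish1_ge0 c t : 0 <= t -> 0 < c -> 0 <= finish1 n c t.
Proof.
move=> t0 c0; have [ct|nct] := pselect (completes c t).
  by apply: le_trans (finish1_ge ct); exact: addr_ge0 (ltW c0).
rewrite /finish1 (_ : [set _ | _] = set0) ?inf0//.
by apply/seteqP; split => // u Su; apply: nct; exists u.
Qed.

Lemma finish1_quiet c t : n (t + c) = n t -> finish1 n c t = t + c.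
Proof.
move=> h; have h' : n (t + c) = n (t + c - c) by rewrite addrK.
by apply/eqP; rewrite eq_le finish1_le//= finish1_ge//; exists (t + c).
Qed.

(** A completion at some [u < x + c] would use a window [(u - c, u]] that starts before [x] and,
    since [y <= t + c <= u], covers the jump between [x] and [y]. *)
Lemma finish1_jump c t x y : completes c t -> 0 <= t -> t <= x -> x <= y ->
  y <= t + c -> n y <> n x -> x + c <= finish1 n c t.
Proof.
move=> [u0 Su0] t0 tx xy ytc nxy; apply: lb_le_inf; first by exists u0.
move=> u [tu nu]; rewrite leNgt; apply/negP => ux; apply: nxy; apply/eqP.
have uc0 : t <= u - c by rewrite lerBrDr.
have y0 := le_trans t0 (le_trans tx xy).
rewrite eqn_leq (n_nd (le_trans t0 tx) xy) andbT.
rewrite (leq_trans (n_nd y0 (le_trans ytc tu)))// nu n_nd ?(le_trans t0)//.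
by rewrite lerBlDr ltW.
Qed.

Lemma finish_ge0 cs t : 0 <= t -> pos cs -> 0 <= finish n cs t.
Proof.
elim: cs t => //= c cs ih t t0 /pos_cons[c0 p].
by apply: ih => //; exact: finish1_ge0.
Qed.

Lemma finish_ge cs t : {in cs, forall c, forall s, 0 <= s -> completes c s} ->
  0 <= t -> pos cs -> t + len cs <= finish n cs t.
Proof.
elim: cs t => [|c cs ih] t h t0; first by rewrite /len big_nil addr0.
move=> /pos_cons[c0 p]; rewrite len_cons addrA /=.
have h1 : t + c <= finish1 n c t by apply: finish1_ge; apply: h; rewrite ?mem_head.
apply: le_trans (ih _ _ _ p); rewrite ?lerD2r//.
  by move=> x xcs; apply: h; rewrite in_cons xcs orbT.
exact: finish1_ge0.
Qed.

End Path.

(** * Pathwise upper and lower estimates of the completion time *)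

Section Functionals.
Context {R : realType} {T : Type} (N : T -> R -> nat).
Hypothesis N_nd : forall w (s t : R), 0 <= s -> s <= t -> (N w s <= N w t)%N.
Implicit Types (c e s t u : R) (cs : seq R) (k m : nat) (w : T).

Definition quiet s t : set T := [set w | N w t = N w s].

Fixpoint fails c t k : set T :=
  if k is j.+1 then fails c t j `&` ~` quiet (t + c * j%:R) (t + c * j.+1%:R)
  else setT.

Definition succeeds c t k := fails c t k `&` quiet (t + c * k%:R) (t + c * k.+1%:R).

(* Bounds the remaining processing time by granting a task of length [c] only
   the attempts that start at times [t + c * k]. *)
Fixpoint blocks cs t w : \bar R :=
  if cs is c :: cs' then
    (\sum_(0 <= k <oo) (c%:E * (\1_(fails c t k) w)%:E
       + (\1_(succeeds c t k) w)%:E * blocks cs' (t + c * k.+1%:R) w))%E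
  else 0%E.

Definition cell t e j : set T :=
  quiet t (t + e * j%:R) `&` ~` quiet (t + e * j%:R) (t + e * j.+1%:R).

(* [upper] and [lower] estimate the completion time from the cell that contains
   the first disruption after [t]. *)
Fixpoint upper m cs t w : \bar R :=
  if cs is c :: cs' then
    (\sum_(j < m) (\1_(cell t (c / m%:R) j) w)%:E *
        ((c / m%:R * j.+1%:R)%:E + blocks cs (t + c / m%:R * j.+1%:R) w)
     + (\1_(quiet t (t + c)) w)%:E * (c%:E + upper m cs' (t + c) w))%E
  else 0%E.

Fixpoint lower m cs t w : R :=
  if cs is c :: cs' then
    \sum_(j < m) \1_(cell t (c / m%:R) j) w * (c / m%:R * j%:R + len cs)
     + \1_(quiet t (t + c)) w * (c + lower m cs' (t + c) w)
  else 0.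

Lemma upper_cons m c cs t : upper m (c :: cs) t = fun w =>
    (\sum_(j < m) (\1_(cell t (c / m%:R) j) w)%:E *
        ((c / m%:R * j.+1%:R)%:E + blocks (c :: cs) (t + c / m%:R * j.+1%:R) w)
     + (\1_(quiet t (t + c)) w)%:E * (c%:E + upper m cs (t + c) w))%E.
Proof. by []. Qed.

Lemma indic_ge0 (A : set T) w : 0 <= \1_A w :> R.
Proof. by rewrite indicE ler0n. Qed.

Lemma quietss t : quiet t t = setT.
Proof. by apply/seteqP; split. Qed.

Lemma quiet_cat s t u : 0 <= s -> s <= t -> t <= u ->
  quiet s u = quiet s t `&` quiet t u.
Proof.
move=> s0 st tu; apply/seteqP; split => w; rewrite /quiet/=; last by case=> <-.
move=> h; have := N_nd w s0 st; have := N_nd w (le_trans s0 st) tu.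
rewrite h => h1 h2; suff : N w t = N w s by move=> ->.
by apply/eqP; rewrite eqn_leq h1 h2.
Qed.

Lemma fails_le c t k l w : (k <= l)%N -> fails c t l w -> fails c t k w.
Proof.
elim: l => [|l ih]; first by rewrite leqn0 => /eqP ->.
by rewrite leq_eqVlt => /predU1P[->//|]; rewrite ltnS => kl [/(ih kl)].
Qed.

Lemma blocks_ge0 cs t w : pos cs -> (0 <= blocks cs t w)%E.
Proof.
elim: cs t => // c cs ih t /pos_cons[c0 p] /=.
apply: nneseries_ge0 => k _ _; apply: adde_ge0.
  by rewrite -EFinM lee_fin; apply: mulr_ge0; [exact: ltW|exact: indic_ge0].
by apply: mule_ge0; [rewrite lee_fin indic_ge0|exact: ih].
Qed.

Lemma upper_ge0 m cs t w : pos cs -> (0 <= upper m cs t w)%E.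
Proof.
elim: cs t => // c cs ih t p /=; have [c0 p'] := pos_cons p.
apply: adde_ge0.
  apply: sume_ge0 => j _; apply: mule_ge0; first by rewrite lee_fin indic_ge0.
  apply: adde_ge0; last exact: (blocks_ge0 _ _ p).
  by rewrite lee_fin mulr_ge0// divr_ge0// ltW.
apply: mule_ge0; first by rewrite lee_fin indic_ge0.
by apply: adde_ge0; [rewrite lee_fin ltW|exact: ih].
Qed.

Lemma lower_ge0 m cs t w : pos cs -> 0 <= lower m cs t w.
Proof.
elim: cs t => // c cs ih t p /=; have [c0 p'] := pos_cons p.
apply: addr_ge0.
  apply: sumr_ge0 => j _; apply: mulr_ge0; first exact: indic_ge0.
  by rewrite addr_ge0 ?len_ge0// mulr_ge0// divr_ge0// ltW.
apply: mulr_ge0; first exact: indic_ge0.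
by apply: addr_ge0; [exact: ltW|exact: ih].
Qed.

Lemma blocks_term_ge0 c cs t w k : 0 < c -> pos cs ->
  (0 <= c%:E * (\1_(fails c t k) w)%:E
       + (\1_(succeeds c t k) w)%:E * blocks cs (t + c * k.+1%:R) w)%E.
Proof.
move=> c0 p; apply: adde_ge0.
  by rewrite -EFinM lee_fin; apply: mulr_ge0; [exact: ltW|exact: indic_ge0].
by apply: mule_ge0; [rewrite lee_fin indic_ge0|exact: blocks_ge0].
Qed.

(** The events [fails] decrease in [k], so each of the first [k.+1] terms contributes [c], and the
    last one also the blocks of the remaining tasks. *)
Lemma blocks_partial_ge c cs t w k : 0 < c -> pos cs -> fails c t k w ->
  ((c * k.+1%:R)%:E + (\1_(succeeds c t k) w)%:E * blocks cs (t + c * k.+1%:R) w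
   <= blocks (c :: cs) t w)%E.
Proof.
move=> c0 p fk; rewrite [leRHS]/=.
apply: le_trans (nneseries_lim_ge k.+1 _); last first.
  by move=> i _ _; exact: blocks_term_ge0.
rewrite big_nat_recr//=.
rewrite [\1_(fails c t k) w]indicE (mem_set fk) mule1 addeA leeD2r//.
rewrite -addn1 natrD mulrDr mulr1 EFinD leeD2r//.
elim: k fk => [|k ih] fk; first by rewrite big_geq// mulr0.
rewrite big_nat_recr//= -addn1 natrD mulrDr mulr1 EFinD; apply: leeD.
  by apply: ih; exact: (fails_le (leqnSn k) fk).
rewrite [\1_(fails c t k) w]indicE (mem_set (fails_le (leqnSn k) fk)) mule1 leeDl//.
by apply: mule_ge0; [rewrite lee_fin indic_ge0|exact: blocks_ge0].
Qed.

(** If no block succeeds, every event [fails] holds and the lower bounds [c * k.+1] on the series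
    are unbounded. *)
Lemma blocks_succeeds c cs t w : 0 < c -> pos cs ->
  (blocks (c :: cs) t w < +oo)%E -> exists k, succeeds c t k w.
Proof.
move=> c0 p; apply: contraPP => nex.
have F k : fails c t k w.
  elim: k => // k ih /=; split => // q; apply: nex; exists k; split => //.
suff -> : blocks (c :: cs) t w = +oo%E by rewrite ltxx.
apply/eqyP => A A0.
have [k Ak] : exists k : nat, A <= c * k.+1%:R.
  exists (Num.trunc (A / c)); rewrite mulrC -ler_pdivrMr//.
  by apply: ltW; have := truncnS_gt (A / c).
apply: le_trans (blocks_partial_ge c0 p (F k)).
apply: (@le_trans _ _ (c * k.+1%:R)%:E); first by rewrite lee_fin.
rewrite leeDl//; apply: mule_ge0; first by rewrite lee_fin indic_ge0.
exact: blocks_ge0.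
Qed.

Lemma succeeds_completes c t s w : s <= t -> (exists k, succeeds c t k w) ->
  0 < c -> completes (N w) c s.
Proof.
move=> st [k [_ q]] c0; exists (t + c * k.+1%:R); split.
  apply: lerD => //; apply: ler_peMr; [exact: ltW|by rewrite ler1n].
rewrite q; congr (N w _); rewrite -[k.+1]addn1 natrD; ring.
Qed.

(** The induction needs two starting times [s <= t]: a task may really finish before its first
    successful block ends, and the next task then starts earlier than its blocks. *)
Lemma finish_le_blocks cs t s w : pos cs -> 0 <= s -> s <= t ->
  ((finish (N w) cs s)%:E <= t%:E + blocks cs t w)%E.
Proof.
elim: cs t s => [|c cs ih] t s; first by rewrite /= adde0 lee_fin.
move=> /pos_cons[c0 p] s0 st.
have [fin|] := boolP (blocks (c :: cs) t w < +oo)%E; last first.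
  by rewrite -leNgt leye_eq => /eqP ->; rewrite addey// leey.
have [k [fk qk]] := blocks_succeeds c0 p fin.
have := blocks_partial_ge c0 p fk.
rewrite indicE mem_set// mul1e => h.
apply: (@le_trans _ _ (t%:E + ((c * k.+1%:R)%:E + blocks cs (t + c * k.+1%:R) w))%E); last first.
  by rewrite leeD2l.
rewrite addeA -EFinD [finish _ _ _]/=; apply: ih => //.
  exact: finish1_ge0.
apply: finish1_le.
  by apply: lerD => //; apply: ler_peMr; [exact: ltW|rewrite ler1n].
rewrite qk; congr (N w _); rewrite -[k.+1]addn1 natrD; ring.
Qed.

Lemma cell_exists t e m w : ~ quiet t (t + e * m%:R) w ->
  exists j : 'I_m, cell t e j w.
Proof.
elim: m => [|m ih].
  by rewrite mulr0 addr0 quietss => /(_ I).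
have [q nq|nq _] := pselect (quiet t (t + e * m%:R) w).
  by exists ord_max; split => //= q'; apply: nq; rewrite /quiet/= q' q.
by have [j cj] := ih nq; exists (widen_ord (leqnSn m) j).
Qed.

Lemma finish_le_upper m cs t w : (0 < m)%N -> pos cs -> 0 <= t ->
  ((finish (N w) cs t)%:E <= t%:E + upper m cs t w)%E.
Proof.
move=> m0; elim: cs t => [|c cs ih] t p t0; first by rewrite /= adde0.
have [c0 p'] := pos_cons p.
have em : c / m%:R * m%:R = c by rewrite divfK// pnatr_eq0 -lt0n.
have e0 : 0 <= c / m%:R by rewrite divr_ge0// ltW.
have [q|nq] := pselect (quiet t (t + c) w).
  rewrite [finish _ _ _]/= finish1_quiet//.
  apply: le_trans (ih _ p' _) _; first by rewrite addr_ge0// ltW.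
  rewrite EFinD -addeA leeD2l//= [\1_(quiet _ _) w]indicE mem_set// mul1e leeDr//.
  apply: sume_ge0 => j _; apply: mule_ge0; first by rewrite lee_fin indic_ge0.
  apply: adde_ge0; last exact: (blocks_ge0 _ _ p).
  by rewrite lee_fin mulr_ge0.
have [j cj] : exists j : 'I_m, cell t (c / m%:R) j w.
  by apply: cell_exists; rewrite em.
have tj : t <= t + c / m%:R * j.+1%:R by rewrite lerDl mulr_ge0.
(* The true start [t] precedes the end of cell [j], from which the blocks are counted, so the moment
   of the restart never has to be located. *)
apply: le_trans (finish_le_blocks w p t0 tj) _.
rewrite EFinD -addeA leeD2l// [leRHS]/= (bigD1 j)//=.
rewrite indicE mem_set// mul1e -addeA leeDl//.
apply: adde_ge0.
  apply: sume_ge0 => i _; apply: mule_ge0; first by rewrite lee_fin indic_ge0.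
  apply: adde_ge0; last exact: (blocks_ge0 _ _ p).
  by rewrite lee_fin mulr_ge0.
apply: mule_ge0; first by rewrite lee_fin indic_ge0.
by apply: adde_ge0; [rewrite lee_fin ltW|exact: upper_ge0].
Qed.

Lemma indic_cell t e j w : 0 <= t -> 0 <= e -> \1_(cell t e j) w =
  \1_(quiet t (t + e * j%:R)) w - \1_(quiet t (t + e * j.+1%:R)) w :> R.
Proof.
move=> t0 e0; rewrite (@quiet_cat t (t + e * j%:R) (t + e * j.+1%:R))//.
- rewrite /cell !indicE !in_setI in_setC.
  by case: (w \in quiet t _); case: (w \in quiet _ _) => /=; rewrite ?subrr ?subr0.
- by rewrite lerDl mulr_ge0.
- by rewrite lerD2l ler_wpM2l// ler_nat.
Qed.

Lemma sum_indic_cell t e m w : 0 <= t -> 0 <= e ->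
  \sum_(j < m) \1_(cell t e j) w + \1_(quiet t (t + e * m%:R)) w = 1 :> R.
Proof.
move=> t0 e0; elim: m => [|m ih].
  by rewrite big_ord0 mulr0 addr0 quietss indicT add0r.
by rewrite big_ord_recr/= indic_cell// -[RHS]ih; ring.
Qed.

(** On a quiet slot the first task takes exactly its length. On cell [j], [finish1_jump] delays its
    end to at least [c] after the beginning of the cell, and the other tasks take at least their
    lengths. *)
Lemma lower_le_finish m cs t w : (0 < m)%N -> pos cs -> 0 <= t ->
  {in cs, forall c, forall s, 0 <= s -> completes (N w) c s} ->
  t + lower m cs t w <= finish (N w) cs t.
Proof.
move=> m0; elim: cs t => [|c cs ih] t p t0 h; first by rewrite /= addr0.
have [c0 p'] := pos_cons p.
have h' : {in cs, forall c, forall s, 0 <= s -> completes (N w) c s}.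
  by move=> x xcs; apply: h; rewrite in_cons xcs orbT.
have em : c / m%:R * m%:R = c by rewrite divfK// pnatr_eq0 -lt0n.
have e0 : 0 <= c / m%:R by rewrite divr_ge0// ltW.
rewrite -lerBrDl; set B := finish (N w) (c :: cs) t - t.
(* The cells and the quiet event partition the sample space, so [B] splits in the same shape as
   [lower]. *)
have -> : B = \sum_(j < m) \1_(cell t (c / m%:R) j) w * B +
    \1_(quiet t (t + c)) w * B.
  by rewrite -mulr_suml -mulrDl -[X in _ + \1_(quiet _ (_ + X)) _]em sum_indic_cell// mul1r.
rewrite /=; apply: lerD; last first.
  rewrite indicE; case: (boolP (w \in _)) => [/set_mem q|_]; last by rewrite !mul0r.
  rewrite !mul1r /B/= finish1_quiet//.
  by rewrite lerBrDl addrA; apply: ih => //; rewrite addr_ge0// ltW.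
apply: ler_sum => j _; rewrite indicE.
case: (boolP (w \in _)) => [/set_mem[q nq]|_]; last by rewrite !mul0r.
rewrite !mul1r /B lerBrDl len_cons /=.
have hc : completes (N w) c t by apply: h; rewrite ?mem_head.
apply: le_trans (finish_ge h' (finish1_ge0 _ t0 c0) p').
rewrite !addrA lerD2r; apply: (finish1_jump (N_nd w) hc t0 _ _ _ nq).
- by rewrite lerDl mulr_ge0.
- by rewrite lerD2l ler_wpM2l// ler_nat.
- by rewrite lerD2l -[leRHS]em ler_wpM2l// ler_nat.
Qed.

End Functionals.

(** * Integrals of nonnegative functions and of indicators *)

Section Integration.
Context {d} {T : measurableType d} {R : realType}.
Variable mu : {measure set T -> \bar R}.

(* Monotonicity of the integral without measurability of the functions: the
   completion times are not known to be measurable. *)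
Lemma le_integral_ge0 (f g : T -> \bar R) :
  (forall x, 0 <= f x)%E -> (forall x, f x <= g x)%E ->
  (\int[mu]_x f x <= \int[mu]_x g x)%E.
Proof.
move=> f0 fg; have g0 x : (0 <= g x)%E := le_trans (f0 x) (fg x).
rewrite !ge0_integralTE//; apply: le_ereal_sup => _ [h hf <-].
by exists h => // x; exact: le_trans (fg x).
Qed.

Lemma integral_indicM (E D : set T) (f : T -> \bar R) :
  (\int[mu]_(x in E) ((\1_D x)%:E * f x) = \int[mu]_(x in E `&` D) f x)%E.
Proof.
rewrite integral_mkcondr; apply: eq_integral => x _.
by rewrite indicE patchE; case: ifP => _; rewrite ?mul1e ?mul0e.
Qed.

Lemma measurable_EFin_indic (E D : set T) :
  measurable D -> measurable_fun E (fun x => (\1_D x)%:E : \bar R).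
Proof. by move=> mD; apply/measurable_EFinP; exact: measurable_indic. Qed.

Lemma measurable_indicM (D : set T) (f : T -> \bar R) :
  measurable D -> measurable_fun setT f ->
  measurable_fun setT (fun x => (\1_D x)%:E * f x)%E.
Proof.
by move=> mD mf; apply: emeasurable_funM => //; exact: measurable_EFin_indic.
Qed.

End Integration.

(** * Independence of the increments from the past, and the mean of the blocks *)

Section Poisson.
Context {R : realType} (lam : R -> R) (rho : R).
Hypothesis clam : cont_ge0 lam.
Hypothesis lam0 : forall x : R, 0 <= x -> 0 <= lam x.
Hypothesis lamr : forall x : R, 0 <= x -> lam x <= rho.
Context d (Omega : measurableType d) (P : probability Omega R)
  (N : Omega -> R -> nat).
Hypothesis NHPP : is_NHPP P lam N.
Implicit Types (s t : R) (E F : set Omega) (w : Omega).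

Let N_nd : forall w s t, 0 <= s -> s <= t -> (N w s <= N w t)%N.
Proof. by case: NHPP. Qed.

Let pr E : R := fine (P E).

Lemma prE E : measurable E -> P E = (pr E)%:E.
Proof. by move=> mE; rewrite /pr fineK// fin_num_measure. Qed.

Lemma pr_ge0 E : 0 <= pr E.
Proof. by rewrite /pr fine_ge0. Qed.

Lemma pr_setD E F : measurable E -> measurable F -> F `<=` E ->
  pr (E `\` F) = pr E - pr F.
Proof.
move=> mE mF FE.
have h : P (E `\` F) = (P E - P F)%E.
  by rewrite -[in RHS](setIidr FE); apply: measureD => //; rewrite ltey_eq fin_num_measure.
by rewrite /pr h fineB ?fin_num_measure.
Qed.

Definition incr m (tt : nat -> R) (k : nat -> nat) : set Omega :=
  [set w | forall j, (j < m)%N -> (N w (tt j.+1) - N w (tt j))%N = k j].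

(* [E] behaves like an event of the history up to [t]: it is independent of the
   increments after [t]. *)
Definition past t E := measurable E /\
  forall m (tt : nat -> R) (k : nat -> nat),
    tt 0%N = t -> (forall j, (j < m)%N -> tt j <= tt j.+1) ->
    measurable (E `&` incr m tt k) /\
    P (E `&` incr m tt k)
      = (P E * (\prod_(j < m) pois (integ lam (tt j) (tt j.+1)) (k j))%:E)%E.

Lemma past0 : past 0 setT.
Proof.
split=> // m tt k t0 ttle; rewrite setTI probability_setT mul1e.
by case: NHPP => _ _ _; exact.
Qed.

(** The increment from [t] to [s] is put in front of the later ones; this gives a single list of
    increments from [t], to which the independence of [E] applies. *)
Lemma past_incr t s x E : t <= s -> past t E ->
  past s (E `&` [set w | (N w s - N w t)%N = x]) /\
  P (E `&` [set w | (N w s - N w t)%N = x])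
    = (P E * (pois (integ lam t s) x)%:E)%E.
Proof.
move=> ts [mE pE].
have key m (tt : nat -> R) (k : nat -> nat) :
    tt 0%N = s -> (forall j, (j < m)%N -> tt j <= tt j.+1) ->
    let F := E `&` [set w | (N w s - N w t)%N = x] `&` incr m tt k in
    measurable F /\ P F = (P E * (pois (integ lam t s) x)%:E *
      (\prod_(j < m) pois (integ lam (tt j) (tt j.+1)) (k j))%:E)%E.
  move=> tt0 ttle.
  pose tt' j := if j is i.+1 then tt i else t.
  pose k' j := if j is i.+1 then k i else x.
  have -> : E `&` [set w | (N w s - N w t)%N = x] `&` incr m tt k =
      E `&` incr m.+1 tt' k'.
    rewrite -setIA; congr (_ `&` _); apply/seteqP; split => w.
      by move=> [h1 h2] [_|j]; [rewrite /= tt0|exact: h2].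
    by move=> h; split; [have := h 0%N isT; rewrite /= tt0|move=> j; exact: (h j.+1)].
  have [|h1 h2] := pE m.+1 tt' k' erefl.
    by move=> [_|j]; [rewrite /= tt0|exact: ttle].
  by split => //; rewrite h2 big_ord_recl EFinM muleA /= tt0.
(* An empty list of later increments yields the probability of the event itself. *)
have := key 0%N (fun=> s) (fun=> 0%N) erefl; rewrite /=.
have -> : incr 0 (fun=> s) (fun=> 0%N) = setT by apply/seteqP; split.
rewrite setIT big_ord0 mule1 => -[//|mF pF].
split => //; split => // m tt k tt0 ttle.
by rewrite pF; exact: key.
Qed.

Lemma past_bigcup t (F : nat -> set Omega) : (forall x, past t (F x)) ->
  trivIset setT F -> past t (\bigcup_x F x).
Proof.
move=> pF tF; split; first by apply: bigcup_measurable => x _; case: (pF x).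
move=> m tt k tt0 ttle; rewrite setI_bigcupl.
have mF x : measurable (F x `&` incr m tt k).
  by have [_ h] := pF x; have [] := h m tt k tt0 ttle.
split; first exact: bigcup_measurable.
rewrite !measure_semi_bigcup//.
- rewrite muleC -nneseriesZl//; apply: eq_eseriesr => x _.
  by have [_ h] := pF x; have [_ h2] := h m tt k tt0 ttle; exact: etrans h2 (muleC _ _).
- by move=> x; case: (pF x).
- by apply: bigcup_measurable => x _; case: (pF x).
- by apply: trivIset_setIr.
- exact: bigcup_measurable.
Qed.

(** [E] is the disjoint union of its parts with exactly [x] disruptions in [(t, s]], and each part
    is a past event at [s]. *)
Lemma past_le t s E : t <= s -> past t E -> past s E.
Proof.
move=> ts pE; pose F x := E `&` [set w | (N w s - N w t)%N = x].
have -> : E = \bigcup_x F x.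
  apply/seteqP; split => [w Ew|w [x _ []]//].
  by exists (N w s - N w t)%N.
apply: past_bigcup => [x|]; first by case: (past_incr x ts pE).
by move=> x y _ _ [w [[_ <-] [_ <-]]].
Qed.

(** As in a Dynkin system, only proper differences are taken: independence need not survive
    intersections. *)
Lemma past_setD t E F : F `<=` E -> past t E -> past t F -> past t (E `\` F).
Proof.
move=> FE [mE pE] [mF pF]; split; first exact: measurableD.
move=> m tt k tt0 ttle.
have [mE' pE'] := pE m tt k tt0 ttle; have [mF' pF'] := pF m tt k tt0 ttle.
have -> : (E `\` F) `&` incr m tt k = (E `&` incr m tt k) `\` (F `&` incr m tt k).
  by apply/seteqP; split => w /=; tauto.
split; first exact: measurableD.
rewrite prE ?pr_setD//; try exact: measurableD; try exact: setSI.
by rewrite prE ?pr_setD//; [rewrite /pr pE' pF' !prE//= -EFinM mulrBl|exact: measurableD].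
Qed.

(** Subtraction on [nat] truncates, so a zero difference only says [<=]; monotonicity of the path
    gives equality. *)
Lemma quietE t s : 0 <= t -> t <= s ->
  quiet N t s = [set w | (N w s - N w t)%N = 0%N].
Proof.
move=> t0 ts; apply/seteqP; split => w; rewrite /quiet/=; first by move=> ->; rewrite subnn.
by move/eqP; rewrite subn_eq0 => h; apply/eqP; rewrite eqn_leq h N_nd.
Qed.

Lemma past_quiet t s E : 0 <= t -> t <= s -> past t E ->
  past s (E `&` quiet N t s) /\
  pr (E `&` quiet N t s) = pr E * expR (- integ lam t s).
Proof.
move=> t0 ts pE; rewrite quietE//; have [h1 h2] := past_incr 0%N ts pE.
split => //; rewrite /pr h2 prE; last by case: pE.
by rewrite -EFinM/= /pois expr0 fact0 mulr1 divr1.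
Qed.

Lemma past_unquiet t s E : 0 <= t -> t <= s -> past t E ->
  past s (E `&` ~` quiet N t s) /\
  pr (E `&` ~` quiet N t s) = pr E * (1 - expR (- integ lam t s)).
Proof.
move=> t0 ts pE; have [h1 h2] := past_quiet t0 ts pE.
have -> : E `&` ~` quiet N t s = E `\` (E `&` quiet N t s).
  by rewrite setDIr setDv set0U setDE.
split; first by apply: past_setD => //; exact: past_le pE.
have [mE _] := pE; have [mEq _] := h1.
by rewrite pr_setD// h2; ring.
Qed.

Lemma pastT t : 0 <= t -> past t setT.
Proof. by move=> t0; exact: past_le past0. Qed.

Lemma measurable_quiet t s : 0 <= t -> t <= s -> measurable (quiet N t s).
Proof.
by move=> t0 ts; have [[]] := past_quiet t0 ts (pastT t0); rewrite setTI.
Qed.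

Lemma past_fails t c k E : 0 <= t -> 0 <= c -> past t E ->
  past (t + c * k%:R) (E `&` fails N c t k).
Proof.
move=> t0 c0 pE; elim: k => [|k ih]; first by rewrite mulr0 addr0 setIT.
rewrite /= setIA; apply: (proj1 (past_unquiet _ _ ih)).
  by rewrite addr_ge0// mulr_ge0.
by rewrite lerD2l ler_wpM2l// ler_nat.
Qed.

Lemma past_succeeds t c k E : 0 <= t -> 0 <= c -> past t E ->
  [/\ past (t + c * k.+1%:R) (E `&` succeeds N c t k),
    pr (E `&` succeeds N c t k) =
      pr (E `&` fails N c t k) * expR (- integ lam (t + c * k%:R) (t + c * k.+1%:R)) &
    pr (E `&` fails N c t k.+1) =
      pr (E `&` fails N c t k) - pr (E `&` succeeds N c t k)].
Proof.
move=> t0 c0 pE; have pF := past_fails k t0 c0 pE.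
have t1 : 0 <= t + c * k%:R by rewrite addr_ge0// mulr_ge0.
have t2 : t + c * k%:R <= t + c * k.+1%:R by rewrite lerD2l ler_wpM2l// ler_nat.
have [h1 h2] := past_quiet t1 t2 pF; have [_ h3] := past_unquiet t1 t2 pF.
rewrite /succeeds/= !setIA h3 h2; split => //; ring.
Qed.

Lemma measurable_fails t c k : 0 <= t -> 0 <= c -> measurable (fails N c t k).
Proof.
by move=> t0 c0; have [] := past_fails k t0 c0 (pastT t0); rewrite setTI.
Qed.

Lemma measurable_succeeds t c k : 0 <= t -> 0 <= c -> measurable (succeeds N c t k).
Proof.
by move=> t0 c0; have [[]] := past_succeeds k t0 c0 (pastT t0); rewrite setTI.
Qed.

(** A geometric number of attempts of length [c], each succeeding with probability
    [expR (- (rho * c))], has this mean duration. *)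
Definition blockmean cs := \sum_(c <- cs) c * expR (rho * c).

Lemma blockmean_ge0 cs : pos cs -> 0 <= blockmean cs.
Proof.
move=> p; rewrite /blockmean big_seq; apply: sumr_ge0 => c /p /ltW c0.
by rewrite mulr_ge0// expR_ge0.
Qed.

Lemma measurable_blocks cs t : pos cs -> 0 <= t ->
  measurable_fun setT (blocks N cs t).
Proof.
elim: cs t => [|c cs ih] t; first by move=> _ _; exact: measurable_cst.
move=> /pos_cons[c0 p] t0.
apply: (ge0_emeasurable_sum (P := xpredT)) => [k w _ _|k _].
  exact: blocks_term_ge0.
apply: emeasurable_funD.
  apply: measurable_funeM; apply: measurable_EFin_indic.
  by apply: measurable_fails => //; exact: ltW.
apply: measurable_indicM; first by apply: measurable_succeeds => //; exact: ltW.
by apply: ih => //; rewrite addr_ge0// mulr_ge0// ltW.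
Qed.

(** After [k] failures block [k] succeeds with probability at least [expR (- (rho * c))], so
    [c * F k] is at most [c * expR (rho * c)] times [F k - F k.+1], and these differences telescope.
    The event [E] is general because the induction continues from [E] intersected with a success. *)
Lemma integral_blocks cs t E : pos cs -> 0 <= t -> past t E ->
  (\int[P]_(w in E) blocks N cs t w <= (pr E * blockmean cs)%:E)%E.
Proof.
elim: cs t E => [|c cs ih] t E.
  by move=> _ _ _; rewrite /= integral0 /blockmean big_nil mulr0.
move=> pcs t0 pE; have [c0 p] := pos_cons pcs.
have [mE _] := pE.
pose term k w := (c%:E * (\1_(fails N c t k) w)%:E
  + (\1_(succeeds N c t k) w)%:E * blocks N cs (t + c * k.+1%:R) w)%E.
have tk k : 0 <= t + c * k%:R by rewrite addr_ge0// mulr_ge0// ltW.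
have mb k : measurable_fun setT (blocks N cs (t + c * k.+1%:R)).
  by apply: measurable_blocks.
have mt1 k : measurable_fun setT (fun w => c%:E * (\1_(fails N c t k) w)%:E)%E.
  apply: measurable_funeM; apply: measurable_EFin_indic.
  by apply: measurable_fails => //; exact: ltW.
have mt2 k : measurable_fun setT (fun w => (\1_(succeeds N c t k) w)%:E * blocks N cs (t + c * k.+1%:R) w)%E.
  by apply: measurable_indicM => //; apply: measurable_succeeds => //; exact: ltW.
have V0 := blockmean_ge0 p.
pose F k := pr (E `&` fails N c t k).
have b k : (\int[P]_(w in E) term k w <=
    ((c * expR (rho * c) + blockmean cs) * (F k - F k.+1))%:E)%E.
  have [pS eS eF] := past_succeeds k t0 (ltW c0) pE.
  rewrite ge0_integralD//; last 4 first.
  - by move=> w _; rewrite -EFinM lee_fin; apply: mulr_ge0; [exact: ltW|exact: indic_ge0].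
  - exact: measurable_funTS.
  - by move=> w _; apply: mule_ge0; [rewrite lee_fin indic_ge0|exact: blocks_ge0].
  - exact: measurable_funTS.
  have mF : measurable_fun E (fun w => (\1_(fails N c t k) w)%:E : \bar R).
    by apply: measurable_EFin_indic; apply: measurable_fails => //; exact: ltW.
  rewrite ge0_integralZl//; last by rewrite lee_fin ltW.
  have -> : (\int[P]_(w in E) (\1_(fails N c t k) w)%:E = (F k)%:E)%E.
    rewrite integral_indic//; last by apply: measurable_fails => //; exact: ltW.
    by rewrite setIC; apply: prE; case: (past_fails k t0 (ltW c0) pE).
  rewrite integral_indicM.
  apply: le_trans (leeD2l _ (ih _ _ p (tk k.+1) pS)) _.
  rewrite -EFinM -EFinD lee_fin.
  have -> : F k - F k.+1 = pr (E `&` succeeds N c t k) by rewrite /F eF; ring.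
  rewrite mulrDl [blockmean _ * _]mulrC lerD2r -mulrA ler_wpM2l ?(ltW c0)//.
  have hr : integ lam (t + c * k%:R) (t + c * k.+1%:R) <= rho * c.
    have h : t + c * k%:R <= t + c * k.+1%:R.
      by rewrite lerD2l; apply: ler_wpM2l; [exact: ltW|rewrite ler_nat].
    apply: le_trans (integ_rate_le clam lamr (tk k) h) _.
    suff -> : t + c * k.+1%:R - (t + c * k%:R) = c by [].
    by rewrite -[k.+1]addn1 natrD; ring.
  rewrite eS mulrCA; apply: ler_peMr; first exact: pr_ge0.
  rewrite -expRD; apply: le_trans (expR_ge1Dx _).
  by move: hr; lra.
have tE0 k w : E w -> (0 <= term k w)%E by move=> _; exact: blocks_term_ge0.
rewrite [X in (X <= _)%E](_ : _ = (\sum_(0 <= k <oo) \int[P]_(w in E) term k w)%E); last first.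
  rewrite -integral_nneseries// => k; apply: measurable_funTS.
  exact: emeasurable_funD.
apply: lime_le.
  by apply: is_cvg_nneseries => k _ _; apply: integral_ge0 => w; exact: tE0.
(* The partial sums telescope to [F 0 - F K], which is at most [pr E]. *)
apply: nearW => K; apply: (@le_trans _ _
    (\sum_(0 <= k < K) ((c * expR (rho * c) + blockmean cs) * (F k - F k.+1))%:E)%E).
  by apply: lee_sum => k _; exact: b.
rewrite sumEFin lee_fin -mulr_sumr.
have -> : blockmean (c :: cs) = c * expR (rho * c) + blockmean cs by exact: big_cons.
rewrite mulrC ler_wpM2r//.
  by rewrite addr_ge0// mulr_ge0 ?expR_ge0// ltW.
have -> : \sum_(0 <= k < K) (F k - F k.+1) = F 0%N - F K.
  by elim: K => [|K ihK]; [rewrite big_geq// subrr|rewrite big_nat_recr//= ihK; ring].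
by rewrite {1}/F /= setIT lerBlDr lerDl; exact: pr_ge0.
Qed.

End Poisson.

(** Factoring out [expR (- x) <= 1] and using [1 - D <= expR (- D)] gives the upper bound; factoring
    out [expR (- (x + D)) >= 1 - q] and using [1 + D <= expR D] gives the lower one. *)
Lemma expRN_sub_bounds {R : realType} (x D q : R) : 0 <= x -> 0 <= D -> x + D <= q ->
  [/\ 0 <= expR (- x) - expR (- (x + D)), expR (- x) - expR (- (x + D)) <= D &
     D * (1 - q) <= expR (- x) - expR (- (x + D))].
Proof.
move=> x0 D0 xDq.
have ex := expR_ge0 (- x); have ey := expR_ge0 (- (x + D)).
have b2 := expR_ge1Dx (- (x + D)).
have e1 : expR (- x) = expR (- (x + D)) * expR D by rewrite -expRD; congr expR; ring.
have e2 : expR (- (x + D)) = expR (- x) * expR (- D) by rewrite -expRD; congr expR; ring.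
have bD := expR_ge1Dx D; have bD' := expR_ge1Dx (- D).
have x1 : expR (- x) <= 1 by rewrite expR_le1 oppr_le0.
split.
- by rewrite subr_ge0 ler_expR lerN2 lerDl.
- have := ler_wpM2l ex bD'; rewrite -e2.
  by have := ler_wpM2r D0 x1; lra.
- have := ler_wpM2l ey bD; rewrite -e1.
  have h : 1 - q <= expR (- (x + D)) by lra.
  by have := ler_wpM2l D0 h; lra.
Qed.

(** * Expectations of the pathwise estimates *)

Section Bounds.
Context {R : realType} (lam : R -> R) (rho : R).
Hypothesis clam : cont_ge0 lam.
Hypothesis lam0 : forall x : R, 0 <= x -> 0 <= lam x.
Hypothesis lamr : forall x : R, 0 <= x -> lam x <= rho.
Context d (Omega : measurableType d) (P : probability Omega R)
  (N : Omega -> R -> nat).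
Hypothesis NHPP : is_NHPP P lam N.
Variable m : nat.
Hypothesis m0 : (0 < m)%N.
Implicit Types (t s e c : R) (cs : seq R) (E : set Omega) (w : Omega).

Let N_nd : forall w s t, 0 <= s -> s <= t -> (N w s <= N w t)%N.
Proof. by case: NHPP. Qed.

Let pr E : R := fine (P E).
Let rho0 : 0 <= rho := rate_ge0 lam0 lamr.

(** The probability that the first disruption after [t] falls in the [j]-th cell. *)
Definition cellmass t e j : R :=
  expR (- integ lam t (t + e * j%:R)) - expR (- integ lam t (t + e * j.+1%:R)).

Lemma cellmass_bounds t e (j : nat) : 0 <= t -> 0 <= e ->
  let D := integ lam (t + e * j%:R) (t + e * j.+1%:R) in
  [/\ 0 <= cellmass t e j, cellmass t e j <= D &
     D * (1 - rho * (e * j.+1%:R)) <= cellmass t e j].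
Proof.
move=> t0 e0 D; have tj : t <= t + e * j%:R by rewrite lerDl mulr_ge0.
have tj' : t <= t + e * j.+1%:R by rewrite lerDl mulr_ge0.
have D0 : 0 <= D by apply: (integ_rate_ge0 lam0); exact: le_trans tj.
have x0 : 0 <= integ lam t (t + e * j%:R) by exact: (integ_rate_ge0 lam0).
have y0 : integ lam t (t + e * j.+1%:R) <= rho * (e * j.+1%:R).
  apply: le_trans (integ_rate_le clam lamr t0 tj') _.
  by rewrite addrAC subrr add0r.
have g : integ lam t (t + e * j.+1%:R) = integ lam t (t + e * j%:R) + D.
  exact: integ_grid.
rewrite /cellmass g; apply: expRN_sub_bounds => //.
by rewrite -g.
Qed.

Lemma sum_cellmass t e k : \sum_(j < k) cellmass t e j =
  1 - expR (- integ lam t (t + e * k%:R)).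
Proof.
elim: k => [|k ih]; first by rewrite big_ord0 mulr0 addr0 integ_id oppr0 expR0 subrr.
rewrite big_ord_recr/= ih /cellmass addrA subrK; reflexivity.
Qed.

Lemma past_cell t e j E : 0 <= t -> 0 <= e -> past lam P N t E ->
  past lam P N (t + e * j.+1%:R) (E `&` cell N t e j) /\
  pr (E `&` cell N t e j) = pr E * cellmass t e j.
Proof.
move=> t0 e0 pE.
have t1 : t <= t + e * j%:R by rewrite lerDl mulr_ge0.
have t2 : t + e * j%:R <= t + e * j.+1%:R by rewrite lerD2l ler_wpM2l// ler_nat.
have [h1 h2] := past_quiet NHPP t0 t1 pE.
have [h3 h4] := past_unquiet NHPP (le_trans t0 t1) t2 h1.
rewrite /cell setIA; split; first exact: h3.
by rewrite /pr h4 h2 /cellmass integ_grid// opprD expRD -mulrA mulrBr mulr1.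
Qed.

Lemma measurable_cell t e j : 0 <= t -> 0 <= e -> measurable (cell N t e j).
Proof.
by move=> t0 e0; have [[]] := past_cell j t0 e0 (pastT NHPP t0); rewrite setTI.
Qed.

Lemma measurable_upper cs t : pos cs -> 0 <= t ->
  measurable_fun setT (upper N m cs t).
Proof.
elim: cs t => [|c cs ih] t p t0; first exact: measurable_cst.
have [c0 p'] := pos_cons p.
have e0 : 0 <= c / m%:R by rewrite divr_ge0// ltW.
have ct : t <= t + c by rewrite lerDl ltW.
apply: emeasurable_funD.
  apply: emeasurable_sum => j.
  apply: measurable_indicM; first exact: measurable_cell.
  apply: emeasurable_funD; first exact: measurable_cst.
  by apply: (measurable_blocks NHPP) => //; rewrite addr_ge0// mulr_ge0.
apply: measurable_indicM; first exact: (measurable_quiet NHPP).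
apply: emeasurable_funD; first exact: measurable_cst.
by apply: ih => //; exact: le_trans ct.
Qed.

Lemma measurable_lower cs t : pos cs -> 0 <= t ->
  measurable_fun setT (lower N m cs t).
Proof.
elim: cs t => [|c cs ih] t p t0; first exact: measurable_cst.
have [c0 p'] := pos_cons p.
have e0 : 0 <= c / m%:R by rewrite divr_ge0// ltW.
have ct : t <= t + c by rewrite lerDl ltW.
apply: measurable_funD.
  apply: measurable_sum => j.
  apply: measurable_funM; last exact: measurable_cst.
  by apply: measurable_indic; exact: measurable_cell.
apply: measurable_funM.
  by apply: measurable_indic; exact: (measurable_quiet NHPP).
apply: measurable_funD; first exact: measurable_cst.
by apply: ih => //; exact: le_trans ct.
Qed.

Lemma integral_addc E (k : R) (f : Omega -> \bar R) :
  measurable E -> 0 <= k -> (forall w, (0 <= f w)%E) -> measurable_fun setT f ->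
  (\int[P]_(w in E) (k%:E + f w) = (k * pr E)%:E + \int[P]_(w in E) f w)%E.
Proof.
move=> mE k0 f0 mf; rewrite ge0_integralD//; last exact: measurable_funTS.
congr (_ + _)%E; rewrite integral_cst//.
by rewrite EFinM /pr fineK// fin_num_measure.
Qed.

Lemma waste1_ge0 cs t : pos cs -> 0 <= t -> 0 <= waste1 lam cs t.
Proof.
elim: cs t => // c cs ih t /pos_cons[c0 p] t0 /=.
by rewrite addr_ge0 ?moment_ge0// ih// addr_ge0// ltW.
Qed.

Lemma blockmean_le cs : pos cs -> {in cs, forall c, rho * c <= 1 / 2} ->
  blockmean rho cs <= len cs + 7 / 5 * rho * sq cs.
Proof.
move=> p h; rewrite /len /sq mulr_sumr -big_split/= /blockmean big_seq [leRHS]big_seq.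
apply: ler_sum => c ccs; have c0 := ltW (p c ccs).
have := ler_wpM2l c0 (expR_le_affine (mulr_ge0 rho0 c0) (h c ccs)).
lra.
Qed.

(** The first slot is split into its cells, where [integral_blocks] applies, and the quiet event,
    whose intersection with [E] is a past event at [t + c], so that the induction goes on. *)
Lemma integral_upper cs t E : pos cs -> {in cs, forall c, rho * c <= 1 / 2} ->
  0 <= t -> past lam P N t E ->
  (\int[P]_(w in E) upper N m cs t w <= (pr E *
    (len cs + waste1 lam cs t + rho * sq cs / m%:R + 7 / 5 * rho ^+ 2 * tailsq cs))%:E)%E.
Proof.
elim: cs t E => [|c cs ih] t E p hr t0 pE.
  by rewrite integral0 /= /len /sq !big_nil !(mulr0, mul0r, addr0).
have [c0 p'] := pos_cons p; have [mE _] := pE.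
have hr' : {in cs, forall c, rho * c <= 1 / 2}.
  by move=> x xcs; apply: hr; rewrite in_cons xcs orbT.
set e := c / m%:R.
have em : e * m%:R = c by rewrite /e divfK// pnatr_eq0 -lt0n.
have e0 : 0 <= e by rewrite /e divr_ge0// ltW.
have ct : t <= t + c by rewrite lerDl ltW.
have tj (j : nat) : 0 <= t + e * j.+1%:R by rewrite addr_ge0// mulr_ge0.
have B0 := blockmean_ge0 rho p.
have cellb (j : 'I_m) : (\int[P]_(w in E) ((\1_(cell N t e j) w)%:E *
      ((e * j.+1%:R)%:E + blocks N (c :: cs) (t + e * j.+1%:R) w))
    <= (pr E * (cellmass t e j * (e * j.+1%:R + blockmean rho (c :: cs))))%:E)%E.
  have [pC eC] := past_cell j t0 e0 pE; have [mC _] := pC.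
  rewrite integral_indicM integral_addc//; last 3 first.
  - by rewrite mulr_ge0.
  - by move=> w; exact: blocks_ge0.
  - exact: (measurable_blocks NHPP).
  apply: le_trans (leeD2l _ (integral_blocks clam lamr NHPP p (tj j) pC)) _.
  by rewrite -/(pr _) -EFinD lee_fin eC mulrC -mulrDr -mulrA.
have [pQ eQ] := past_quiet NHPP t0 ct pE; have [mQ _] := pQ.
have ct0 := le_trans t0 ct.
have quietb : (\int[P]_(w in E) ((\1_(quiet N t (t + c)) w)%:E *
      (c%:E + upper N m cs (t + c) w))
   <= (pr E * (expR (- integ lam t (t + c)) * (c + (len cs + waste1 lam cs (t + c)
         + rho * sq cs / m%:R + 7 / 5 * rho ^+ 2 * tailsq cs))))%:E)%E.
  rewrite integral_indicM integral_addc//; last 3 first.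
  - exact: ltW.
  - by move=> w; exact: upper_ge0.
  - exact: measurable_upper.
  apply: le_trans (leeD2l _ (ih _ _ p' hr' ct0 pQ)) _.
  by rewrite -EFinD lee_fin /pr eQ; rewrite le_eqVlt; apply/predU1P; left; ring.
rewrite upper_cons ge0_integralD//; last 4 first.
- move=> w _; apply: sume_ge0 => j _; apply: mule_ge0.
    by rewrite lee_fin indic_ge0.
  by apply: adde_ge0; [rewrite lee_fin mulr_ge0|exact: (blocks_ge0 N _ _ p)].
- apply: measurable_funTS.
  apply: emeasurable_sum => j.
  apply: measurable_indicM; first exact: measurable_cell.
  apply: emeasurable_funD; first exact: measurable_cst.
  exact: (measurable_blocks NHPP).
- move=> w _; apply: mule_ge0; first by rewrite lee_fin indic_ge0.
  by apply: adde_ge0; [rewrite lee_fin ltW|exact: upper_ge0].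
- apply: measurable_funTS; apply: measurable_indicM.
    exact: (measurable_quiet NHPP).
  by apply: emeasurable_funD; [exact: measurable_cst|exact: measurable_upper].
apply: le_trans (leeD2l _ quietb) _.
rewrite ge0_integral_sum//; last 2 first.
- move=> j; apply: measurable_funTS.
  apply: measurable_indicM; first exact: measurable_cell.
  apply: emeasurable_funD; first exact: measurable_cst.
  exact: (measurable_blocks NHPP).
- move=> j w _; apply: mule_ge0; first by rewrite lee_fin indic_ge0.
  by apply: adde_ge0; [rewrite lee_fin mulr_ge0|exact: (blocks_ge0 N _ _ p)].
apply: (le_trans (leeD2r _ (lee_sum _ (fun j _ => cellb j)))).
rewrite sumEFin -EFinD lee_fin -mulr_sumr -mulrDr ler_wpM2l ?pr_ge0//.
have -> : \sum_(j < m) cellmass t e j * (e * j.+1%:R + blockmean rho (c :: cs)) =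
    \sum_(j < m) cellmass t e j * (e * j.+1%:R)
    + (1 - expR (- integ lam t (t + c))) * blockmean rho (c :: cs).
  rewrite -[X in integ lam t (_ + X)]em -sum_cellmass mulr_suml -big_split/=.
  by apply: eq_bigr => j _; rewrite mulrDr.
(* Cell probabilities are at most the integrated rates, and the right Riemann sum costs one grid
   error. *)
have s1 : \sum_(j < m) cellmass t e j * (e * j.+1%:R) <=
    moment lam t (t + c) + e * integ lam t (t + c).
  rewrite -[X in moment _ _ (_ + X)]em -[X in integ lam t (_ + X)]em.
  apply: le_trans (proj2 (grid_moment clam lam0 m t0 e0)).
  apply: ler_sum => j _; apply: ler_wpM2r; first by rewrite mulr_ge0.
  by case: (cellmass_bounds j t0 e0).
have L0 := integ_rate_ge0 lam0 (t + c) t0.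
have L1 : integ lam t (t + c) <= rho * c.
  by apply: le_trans (integ_rate_le clam lamr t0 ct) _; rewrite addrAC subrr add0r.
have bm := blockmean_le p hr.
rewrite [waste1 _ (_ :: _) _]/= [tailsq (_ :: _)]/=.
set L := integ lam t (t + c) in L0 L1 s1 *.
have eL := expR_ge1Dx (- L); have eL1 : expR (- L) <= 1 by rewrite expR_le1 oppr_le0.
set W := waste1 lam cs (t + c); set x := expR (- L) in eL eL1 *.
have W0 : 0 <= W by exact: waste1_ge0.
(* Nonnegativity allows the weight [x <= 1] of the quiet branch to be replaced by 1. *)
have r0 : 0 <= W + rho * sq cs / m%:R + 7 / 5 * rho ^+ 2 * tailsq cs.
  apply: addr_ge0; first by apply: addr_ge0 => //; rewrite divr_ge0// mulr_ge0// sq_ge0.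
  apply: mulr_ge0; first by rewrite mulr_ge0// ?exprn_ge0//; lra.
  elim: (cs) p' => //= x' s' ihs /pos_cons[x0 ps].
  by apply: addr_ge0; [apply: mulr_ge0; [exact: ltW|exact: sq_ge0]|exact: ihs].
have h1 : e * L <= rho * c ^+ 2 / m%:R.
  apply: le_trans (ler_wpM2l e0 L1) _.
  by rewrite le_eqVlt; apply/predU1P; left; rewrite /e; ring.
have y0 : 0 <= 1 - x by lra.
have h2 := ler_wpM2l y0 bm.
have h3 := ler_wpM2r r0 eL1.
have sq0 := sq_ge0 (c :: cs).
(* A disrupted slot has probability [1 - x <= L <= rho * c], which makes the excess of the block
   means second order: this is the new term of [tailsq]. *)
have h4 : (1 - x) * (7 / 5 * rho * sq (c :: cs)) <= rho * c * (7 / 5 * rho * sq (c :: cs)).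
  apply: ler_wpM2r; last lra.
  by apply: mulr_ge0 => //; apply: mulr_ge0 => //; lra.
have es : rho * sq (c :: cs) / m%:R = rho * c ^+ 2 / m%:R + rho * sq cs / m%:R.
  by rewrite sq_cons; ring.
rewrite es; rewrite len_cons in h2 *.
move: s1 h1 h2 h3 h4.
set S1 := \sum_(j < m) _; set B := blockmean _ _; set eL' := e * L.
set SQ := sq (c :: cs); set A1 := rho * c ^+ 2 / m%:R; set A2 := rho * sq cs / m%:R.
by move=> *; lra.
Qed.

(** With [lam <= rho] the left Riemann sum of a slot is at most [rho * c ^+ 2 / 2]. The grid error
    stays on the left because [integral_lower] subtracts it from the waste anyway. *)
Lemma waste1_le cs t : pos cs -> 0 <= t ->
  waste1 lam cs t - rho * sq cs / m%:R <= rho * sq cs / 2.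
Proof.
elim: cs t => [|c cs ih] t; first by rewrite /sq big_nil !(mulr0, mul0r) subr0.
move=> /pos_cons[c0 p] t0 /=.
have ct : t <= t + c by rewrite lerDl ltW.
have := ih _ p (le_trans t0 ct); rewrite sq_cons => h.
set e := c / m%:R.
have em : e * m%:R = c by rewrite /e divfK// pnatr_eq0 -lt0n.
have e0 : 0 <= e by rewrite /e divr_ge0// ltW.
have [g _] := grid_moment clam lam0 m t0 e0; rewrite em in g.
have L1 : integ lam t (t + c) <= rho * c.
  by apply: le_trans (integ_rate_le clam lamr t0 ct) _; rewrite addrAC subrr add0r.
have h1 : e * integ lam t (t + c) <= rho * c ^+ 2 / m%:R.
  apply: le_trans (ler_wpM2l e0 L1) _.
  by rewrite le_eqVlt; apply/predU1P; left; rewrite /e; ring.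
have h2 : \sum_(j < m) integ lam (t + e * j%:R) (t + e * j.+1%:R) * (e * j%:R)
    <= rho * c ^+ 2 / 2.
  apply: (@le_trans _ _ (\sum_(j < m) rho * e ^+ 2 * j%:R)).
    apply: ler_sum => j _.
    have jj : t + e * j%:R <= t + e * j.+1%:R by rewrite lerD2l ler_wpM2l// ler_nat.
    have tj : 0 <= t + e * j%:R by rewrite addr_ge0// mulr_ge0.
    have -> : rho * e ^+ 2 * j%:R = rho * (t + e * j.+1%:R - (t + e * j%:R)) * (e * j%:R).
      by rewrite -[j.+1]addn1 natrD; ring.
    by apply: ler_wpM2r; [rewrite mulr_ge0|exact: (integ_rate_le clam lamr)].
  rewrite -mulr_sumr -[in leRHS]em.
  have -> : rho * (e * m%:R) ^+ 2 / 2 = rho * e ^+ 2 * (m%:R ^+ 2 / 2) by ring.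
  apply: ler_wpM2l; first by rewrite mulr_ge0// sqr_ge0.
  have : \sum_(j < m) (j%:R : R) = (m%:R ^+ 2 - m%:R) / 2.
    elim: (m) => [|k ihk]; first by rewrite big_ord0; ring.
    by rewrite big_ord_recr/= ihk -[k.+1]addn1 natrD; field.
  by move=> ->; have := ler0n R m; lra.
rewrite mulrDr mulrDl; lra.
Qed.

Lemma integral_lower cs t E : pos cs -> 0 <= t -> past lam P N t E ->
  ((pr E * (len cs + waste1 lam cs t - rho * sq cs / m%:R
      - rho ^+ 2 * losserr cs))%:E <= \int[P]_(w in E) (lower N m cs t w)%:E)%E.
Proof.
elim: cs t E => [|c cs ih] t E p t0 pE.
  by rewrite integral0 /= /len /sq !big_nil !(mulr0, mul0r, addr0, subr0).
have [c0 p'] := pos_cons p; have [mE _] := pE.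
set e := c / m%:R.
have em : e * m%:R = c by rewrite /e divfK// pnatr_eq0 -lt0n.
have e0 : 0 <= e by rewrite /e divr_ge0// ltW.
have ct : t <= t + c by rewrite lerDl ltW.
have ct0 := le_trans t0 ct.
pose v (j : 'I_m) := e * j%:R + len (c :: cs).
have v0 j : 0 <= v j by rewrite addr_ge0 ?len_ge0// mulr_ge0.
have cellb (j : 'I_m) : (\int[P]_(w in E) ((v j)%:E * (\1_(cell N t e j) w)%:E)
    = (pr E * (cellmass t e j * v j))%:E)%E.
  have [[mC _] eC] := past_cell j t0 e0 pE.
  rewrite ge0_integralZl//; last 2 first.
  - by apply: measurable_EFin_indic; exact: measurable_cell.
  - by rewrite lee_fin.
  rewrite integral_indic//; last exact: measurable_cell.
  rewrite setIC [X in (_ * X)%E](_ : _ = (pr (E `&` cell N t e j))%:E); last first.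
    by rewrite /pr fineK// fin_num_measure.
  by rewrite -EFinM eC; congr EFin; ring.
have [pQ eQ] := past_quiet NHPP t0 ct pE; have [mQ _] := pQ.
pose r := waste1 lam cs (t + c) - rho * sq cs / m%:R - rho ^+ 2 * losserr cs.
have quietb : ((pr E * (expR (- integ lam t (t + c)) * (c + (len cs + r))))%:E <=
    \int[P]_(w in E) ((\1_(quiet N t (t + c)) w)%:E *
      (c%:E + (lower N m cs (t + c) w)%:E)))%E.
  rewrite integral_indicM integral_addc//; last 3 first.
  - exact: ltW.
  - by move=> w; rewrite lee_fin; exact: lower_ge0.
  - by apply/measurable_EFinP; exact: measurable_lower.
  apply: le_trans (leeD2l _ (ih _ _ p' ct0 pQ)).
  rewrite -EFinD lee_fin /pr eQ le_eqVlt; apply/predU1P; left; rewrite /r; ring.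
have -> : (\int[P]_(w in E) (lower N m (c :: cs) t w)%:E =
    \sum_(j < m) \int[P]_(w in E) ((v j)%:E * (\1_(cell N t e j) w)%:E)
    + \int[P]_(w in E) ((\1_(quiet N t (t + c)) w)%:E *
      (c%:E + (lower N m cs (t + c) w)%:E)))%E.
  rewrite -ge0_integral_sum//; last 2 first.
  - move=> j; apply: measurable_funeM; apply: measurable_EFin_indic.
    exact: measurable_cell.
  - by move=> j w _; rewrite -EFinM lee_fin mulr_ge0// indic_ge0.
  rewrite -ge0_integralD//; last 4 first.
  - by move=> w _; apply: sume_ge0 => j _; rewrite -EFinM lee_fin mulr_ge0// indic_ge0.
  - apply: measurable_funTS; apply: emeasurable_sum => j.
    apply: measurable_funeM; apply: measurable_EFin_indic; exact: measurable_cell.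
  - move=> w _; rewrite -EFinD -EFinM lee_fin; apply: mulr_ge0.
      exact: indic_ge0.
    by apply: addr_ge0; [exact: ltW|exact: lower_ge0].
  - apply: measurable_funTS; apply: measurable_indicM.
      exact: (measurable_quiet NHPP).
    apply: emeasurable_funD; first exact: measurable_cst.
    by apply/measurable_EFinP; exact: measurable_lower.
  apply: eq_integral => w _ /=.
  rewrite EFinD EFinM EFinD; congr (_ + _)%E.
  by rewrite -sumEFin; apply: eq_bigr => j _; rewrite mulrC EFinM.
apply: le_trans (leeD2l _ quietb).
under eq_bigr do rewrite cellb.
rewrite sumEFin -EFinD lee_fin -mulr_sumr -mulrDr ler_wpM2l ?pr_ge0//.
have -> : \sum_(j < m) cellmass t e j * v j =
    \sum_(j < m) cellmass t e j * (e * j%:R)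
    + (1 - expR (- integ lam t (t + c))) * len (c :: cs).
  rewrite -[X in integ lam t (_ + X)]em -sum_cellmass mulr_suml -big_split/=.
  by apply: eq_bigr => j _; rewrite mulrDr.
(* On cell [j] the probability falls short of the integrated rate by an amount that costs at most
   [rho ^+ 2 * e ^+ 3 * (j * j.+1)]; [sum_consec] adds these up to [rho ^+ 2 * c ^+ 3 / 3]. *)
have s1 : moment lam t (t + c) - e * integ lam t (t + c) - rho ^+ 2 * c ^+ 3 / 3 <=
    \sum_(j < m) cellmass t e j * (e * j%:R).
  have [g _] := grid_moment clam lam0 m t0 e0; rewrite em in g.
  apply: (@le_trans _ _
    (\sum_(j < m) integ lam (t + e * j%:R) (t + e * j.+1%:R) * (e * j%:R)
     - \sum_(j < m) rho ^+ 2 * e ^+ 3 * (j%:R * j.+1%:R))).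
    rewrite -mulr_sumr.
    have := ler_wpM2l (_ : 0 <= rho ^+ 2 * e ^+ 3) (@sum_consec R m).
    rewrite mulr_ge0 ?exprn_ge0// => /(_ isT).
    have -> : rho ^+ 2 * e ^+ 3 * (m%:R ^+ 3 / 3) = rho ^+ 2 * c ^+ 3 / 3.
      by rewrite -[in RHS]em; ring.
    by move: g; lra.
  rewrite -sumrB; apply: ler_sum => j _.
  have [_ _ h] := cellmass_bounds j t0 e0.
  have jj : t + e * j%:R <= t + e * j.+1%:R by rewrite lerD2l ler_wpM2l// ler_nat.
  have tj : 0 <= t + e * j%:R by rewrite addr_ge0// mulr_ge0.
  have := integ_rate_le clam lamr tj jj.
  have -> : t + e * j.+1%:R - (t + e * j%:R) = e by rewrite -[j.+1]addn1 natrD; ring.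
  set D := integ lam _ _ in h * => hD.
  have ej : 0 <= e * j%:R by rewrite mulr_ge0.
  apply: le_trans (ler_wpM2r ej h).
  have k0 : 0 <= rho * (e * j.+1%:R) * (e * j%:R).
    by apply: mulr_ge0 => //; apply: mulr_ge0 => //; apply: mulr_ge0.
  have := ler_wpM2r k0 hD; lra.
have L0 := integ_rate_ge0 lam0 (t + c) t0.
have L1 : integ lam t (t + c) <= rho * c.
  by apply: le_trans (integ_rate_le clam lamr t0 ct) _; rewrite addrAC subrr add0r.
rewrite [waste1 _ (_ :: _) _]/= [losserr (_ :: _)]/=.
set L := integ lam t (t + c) in L0 L1 s1 *.
have eL := expR_ge1Dx (- L); have eL1 : expR (- L) <= 1 by rewrite expR_le1 oppr_le0.
set x := expR (- L) in eL eL1 *.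
have h1 : e * L <= rho * c ^+ 2 / m%:R.
  apply: le_trans (ler_wpM2l e0 L1) _.
  by rewrite le_eqVlt; apply/predU1P; left; rewrite /e; ring.
(* The quiet branch has weight [x], so [(1 - x) * r] is missing; an upper bound on [r] controls this
   loss whatever the sign of [r]. *)
have rle : r <= rho * sq cs / 2.
  rewrite /r; have := waste1_le p' ct0.
  have : 0 <= rho ^+ 2 * losserr cs.
    apply: mulr_ge0; first exact: sqr_ge0.
    elim: (cs) p' => //= x' s' ihs /pos_cons[x0 ps].
    apply: addr_ge0; last exact: ihs.
    apply: addr_ge0; first by rewrite divr_ge0// exprn_ge0// ltW.
    by rewrite divr_ge0// mulr_ge0// ?sq_ge0// ltW.
  lra.
have y0 : 0 <= 1 - x by lra.
have h2 := ler_wpM2l y0 rle.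
have h3 : (1 - x) * (rho * sq cs / 2) <= rho * c * (rho * sq cs / 2).
  apply: ler_wpM2r; last lra.
  by rewrite divr_ge0// mulr_ge0// sq_ge0.
have es : rho * sq (c :: cs) / m%:R = rho * c ^+ 2 / m%:R + rho * sq cs / m%:R.
  by rewrite sq_cons; ring.
rewrite es len_cons.
have er : waste1 lam cs (t + c) = r + rho * sq cs / m%:R + rho ^+ 2 * losserr cs.
  by rewrite /r; ring.
rewrite er; move: s1 h1 h2 h3.
set S1 := \sum_(j < m) _; set eL' := e * L.
set A1 := rho * c ^+ 2 / m%:R; set A2 := rho * sq cs / m%:R.
by clearbody r; move=> *; lra.
Qed.

End Bounds.

(** * Bounds on the expected completion time and comparison of two orders *)

Section Expectation.
Context {R : realType} (lam : R -> R) (rho : R).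
Hypothesis clam : cont_ge0 lam.
Hypothesis lam0 : forall x : R, 0 <= x -> 0 <= lam x.
Hypothesis lamr : forall x : R, 0 <= x -> lam x <= rho.
Context d (Omega : measurableType d) (P : probability Omega R)
  (N : Omega -> R -> nat).
Hypothesis NHPP : is_NHPP P lam N.
Implicit Types (m : nat) (cs : seq R).

Let N_nd : forall w (s t : R), 0 <= s -> s <= t -> (N w s <= N w t)%N.
Proof. by case: NHPP. Qed.

Lemma Mexp_le m cs : (0 < m)%N -> pos cs -> {in cs, forall c, rho * c <= 1 / 2} ->
  (Mexp P N cs 0 <= (len cs + waste1 lam cs 0 + rho * sq cs / m%:R
     + 7 / 5 * rho ^+ 2 * tailsq cs)%:E)%E.
Proof.
move=> m0 p hr; rewrite /Mexp.
apply: (@le_trans _ _ (\int[P]_w upper N m cs 0 w)%E).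
  apply: le_integral_ge0 => w; first by rewrite lee_fin subr0 finish_ge0.
  by have := finish_le_upper N w m0 p (lexx 0); rewrite subr0 add0e.
apply: le_trans (integral_upper clam lam0 lamr NHPP m0 p hr (lexx 0) (past0 NHPP)) _.
by rewrite probability_setT /= mul1r.
Qed.

(** For each natural starting time the blocks have finite mean, hence almost surely all of them are
    finite at once; a task started at a real [s] completes in a block begun after a later natural
    time. *)
Lemma ae_completes (c : R) : 0 < c ->
  {ae P, forall w, forall s : R, 0 <= s -> completes (N w) c s}.
Proof.
move=> c0; have p1 : pos [:: c] by move=> x; rewrite inE => /eqP ->.
have : {ae P, forall w, forall i : nat, (blocks N [:: c] i%:R w < +oo)%E}.
  apply: ae_foralln => i.
  have mB := measurable_blocks NHPP p1 (ler0n R i).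
  have iB : P.-integrable setT (blocks N [:: c] i%:R).
    apply/integrableP; split => //.
    under eq_integral do rewrite gee0_abs ?blocks_ge0//.
    apply: le_lt_trans (integral_blocks clam lamr NHPP p1 (ler0n R i) (pastT NHPP (ler0n R i))) _.
    exact: ltry.
  apply: filterS (integrable_ae measurableT iB) => w /(_ I) h.
  by rewrite ltey_eq h.
apply: filterS => w h s s0.
have p0 : pos ([::] : seq R) by [].
apply: succeeds_completes (blocks_succeeds c0 p0 (h (Num.trunc s).+1)) c0.
by apply: ltW; exact: truncnS_gt.
Qed.

Lemma Mexp_ge m cs : (0 < m)%N -> pos cs ->
  ((len cs + waste1 lam cs 0 - rho * sq cs / m%:R - rho ^+ 2 * losserr cs)%:E
    <= Mexp P N cs 0)%E.
Proof.
move=> m0 p; rewrite /Mexp.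
have [B [mB B0 hB]] : {ae P, forall w, forall i : nat, (i < size cs)%N ->
    forall s : R, 0 <= s -> completes (N w) (nth 0 cs i) s}.
  apply: ae_foralln => i; have [ics|ics] := ltnP i (size cs); last first.
    exact: aeW.
  by apply: filterS (ae_completes (p _ (mem_nth 0 ics))) => w h _.
have hB' w : ~ B w -> {in cs, forall c, forall s, 0 <= s -> completes (N w) c s}.
  move=> nB c ccs s s0.
  have h : forall i : nat, (i < size cs)%N ->
    forall s : R, 0 <= s -> completes (N w) (nth 0 cs i) s.
    by apply: contrapT => h; apply: nB; exact: hB.
  by rewrite -(nth_index 0 ccs); apply: h => //; rewrite index_mem.
have mL : measurable_fun setT (fun w => (lower N m cs 0 w)%:E).
  by apply/measurable_EFinP; exact: (measurable_lower clam NHPP m p (lexx 0)).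
apply: (@le_trans _ _ (\int[P]_w (lower N m cs 0 w)%:E)%E).
  have := integral_lower clam lam0 lamr NHPP m0 p (lexx 0) (past0 NHPP).
  by rewrite probability_setT /= mul1r.
(* The null set [B] is removed from the integral of the measurable [lower]; the other side then only
   has to dominate pointwise. *)
rewrite (ge0_negligible_integral mB)//; last first.
  by move=> w _; rewrite lee_fin lower_ge0.
rewrite setDE -integral_indicM; apply: le_integral_ge0 => w.
  by rewrite -EFinM lee_fin mulr_ge0 ?indic_ge0 ?lower_ge0.
rewrite -EFinM lee_fin subr0 indicE.
case: (boolP (w \in _)) => [/set_mem nB|_]; last by rewrite mul0r finish_ge0.
have := lower_le_finish N_nd m0 p (lexx 0) (hB' w nB).
by rewrite mul1r add0r.
Qed.

Lemma Mexp_lt cs cs' : pos cs -> pos cs' -> {in cs, forall c, rho * c <= 1 / 2} ->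
  perm_eq cs cs' ->
  rho ^+ 2 * (len cs * sq cs + 3 / 4 * len cs ^+ 3) <
    prefsum (integ lam 0) cs' 0 - prefsum (integ lam 0) cs 0 ->
  (Mexp P N cs 0 < Mexp P N cs' 0)%E.
Proof.
move=> p p' hr eqcs gap.
have el : len cs = len cs' by exact: perm_big.
have es : sq cs = sq cs' by exact: perm_big.
have ec : cube cs = cube cs' by exact: perm_big.
have b := ler_wpM2l (sqr_ge0 rho) (budget p el es ec p').
pose G := prefsum (integ lam 0) cs' 0 - prefsum (integ lam 0) cs 0
  - rho ^+ 2 * (len cs * sq cs + 3 / 4 * len cs ^+ 3).
have G0 : 0 < G by rewrite subr_gt0.
(* The grid is fine enough for two grid errors, one from each bound, to fit into the strict slack
   [G]. *)
pose m := (Num.trunc (2 * rho * sq cs / G)).+1.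
have hm : 2 * rho * sq cs / m%:R < G.
  have : 2 * rho * sq cs / G < m%:R by exact: truncnS_gt.
  by move=> h; rewrite ltr_pdivrMr ?ltr0n// [ltRHS]mulrC -ltr_pdivrMr.
apply: le_lt_trans (Mexp_le (isT : 0 < m)%N p hr) _.
apply: lt_le_trans (Mexp_ge (isT : 0 < m)%N p').
(* Both orders have the same total length, so the boundary terms of [waste1E] agree and only the
   [prefsum] terms differ. *)
rewrite lte_fin !waste1E// -el -es !add0r !mul0r !addr0.
have e2 : 2 * rho * sq cs / m%:R = rho * sq cs / m%:R + rho * sq cs / m%:R by ring.
rewrite e2 in hm; move: hm b; rewrite /G.
set A := rho * sq cs / m%:R.
set X1 := integ (fun y => y * lam y) 0 _; set X2 := len cs * integ lam 0 _.
lra.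
Qed.

End Expectation.

Lemma prefsum_ord {R : realType} (Lam : R -> R) n (b : 'I_n -> R) t :
  prefsum Lam [seq b i | i <- enum 'I_n] t =
  \sum_(i < n) b i * Lam (t + \sum_(j < n | (j <= i)%N) b j).
Proof.
elim: n b t => [|n ih] b t; first by rewrite enum_ord0 big_ord0.
rewrite enum_ordSl /= -map_comp ih big_ord_recl; congr (_ * Lam (_ + _) + _).
  by rewrite big_mkcond big_ord_recl /= big1 ?addr0.
apply: eq_bigr => i _; congr (_ * Lam _); rewrite -addrA; congr (_ + _).
by rewrite [RHS]big_mkcond big_ord_recl /= -big_mkcond.
Qed.

Unset Implicit Arguments.
Set Strict Implicit.

(* Tasks are indexed by 'I_n.+1 (0-based): the paper's n is our n.+1,
   the paper's a_{i} is our a (i-1), a_n is a ord_max. *)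
Theorem theorem1 (R : realType) (n : nat) (a : 'I_n.+1 -> R)
  (lbar : R) (f : R -> R)
  (d : measure_display) (Omega : measurableType d) (P : probability Omega R)
  (N : Omega -> R -> nat) :
  0 < a ord0 ->
  (forall i j : 'I_n.+1, (i < j)%N -> a i < a j) ->
  0 < lbar ->
  (forall t, 0 <= t -> 0 < f t) ->
  (forall t, 0 <= t -> derivable f t 1) ->
  (exists2 m : R, 0 < m & forall t, 0 <= t -> m <= f t) ->
  (exists M : R, forall t, 0 <= t -> f t <= M) ->
  let fplus := sup [set f t | t in `[0, +oo[%classic] in
  lbar <= 1 / (2 * fplus * a ord_max) ->
  is_NHPP P (fun t => lbar * f t) N ->
  let An := \sum_(i < n.+1) a i in
  let F := integ f 0 in
  let S := fun pi : {perm 'I_n.+1} =>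
             \sum_(i < n.+1) a (pi i) * F (Apref a pi i) in
  let D := fplus ^+ 2 * An * (\sum_(i < n.+1) a i ^+ 2)
           + fplus ^+ 2 * (3 / 4) * An ^+ 3 in
  (* (i) SPT *)
  ((forall x y, 0 <= x -> x < y -> y <= An -> f y < f x) ->
   (forall pi : {perm 'I_n.+1}, pi != 1%g ->
      lbar < (S pi - S 1%g) / D) ->
   forall pi : {perm 'I_n.+1}, pi != 1%g ->
     (Mexp P N (order_seq a 1%g) 0 < Mexp P N (order_seq a pi) 0)%E)
  /\
  (* (ii) LPT *)
  ((forall x y, 0 <= x -> x < y -> y <= An -> f x < f y) ->
   (forall pi : {perm 'I_n.+1}, (exists i, pi i <> rev_ord i) ->
      lbar < (S pi - \sum_(i < n.+1)
                       a (rev_ord i) * F (\sum_(j < n.+1 | (rev_ord i <= j)%N) a j)) / D) ->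
   forall pi : {perm 'I_n.+1}, (exists i, pi i <> rev_ord i) ->
     (Mexp P N [seq a (rev_ord i) | i <- enum 'I_n.+1] 0
        < Mexp P N (order_seq a pi) 0)%E).
Proof.
move=> a0 ainc lbar0 f0 df _ [M fM] fplus hl NHPP An F S D.
have ap i : 0 < a i.
  have [->//|i0] := eqVneq i ord0.
  by apply: lt_trans a0 (ainc _ _ _); rewrite lt0n.
have cf : cont_ge0 f.
  by move=> x x0; apply/differentiable_continuous/derivable1_diffP; exact: df.
have fle x : 0 <= x -> f x <= fplus.
  move=> x0; apply: ub_le_sup; last by exists x => //=; rewrite in_itv/= x0.
  by exists M => z [y /=]; rewrite in_itv/= andbT => y0 <-; exact: fM.
have fp0 : 0 < fplus by exact: lt_le_trans (f0 0 (lexx 0)) (fle 0 (lexx 0)).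
pose lam t := lbar * f t.
have clam : cont_ge0 lam by exact: cont_ge0Z.
have lam0 x : 0 <= x -> 0 <= lam x by move=> x0; rewrite mulr_ge0 ?ltW// f0.
have lamr x : 0 <= x -> lam x <= lbar * fplus.
  by move=> x0; rewrite ler_wpM2l ?fle// ltW.
have amax i : a i <= a ord_max.
  have [->//|im] := eqVneq i ord_max.
  by apply/ltW/ainc; rewrite ltn_neqAle -ltnS ltn_ord andbT.
(* The assumed bound on [lbar] is exactly this inequality for the longest task. *)
have rmax i : lbar * fplus * a i <= 1 / 2.
  apply: (@le_trans _ _ (lbar * fplus * a ord_max)).
    by rewrite ler_wpM2l// ltW// mulr_gt0.
  move: hl; rewrite ler_pdivlMr; last by rewrite !mulr_gt0.
  lra.
have osP pi : pos (order_seq a pi) by move=> _ /mapP[i _ ->].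
have sumE (g : R -> R) pi : \sum_(c <- order_seq a pi) g c = \sum_(i < n.+1) g (a i).
  rewrite big_map big_enum /= [RHS](reindex_inj (@perm_inj _ pi)).
  exact: eq_bigr.
have osE pi pi' : perm_eq (order_seq a pi) (order_seq a pi').
  have H (p : {perm 'I_n.+1}) : perm_eq (order_seq a p) (order_seq a 1%g).
    rewrite /order_seq (map_comp a p) (map_comp a (1%g : {perm _})).
    apply: perm_map; apply: uniq_perm.
    - by rewrite map_inj_uniq ?enum_uniq//; exact: perm_inj.
    - by rewrite map_inj_uniq ?enum_uniq//; exact: perm_inj.
    move=> i; transitivity true; last apply/esym.
      by apply/mapP; exists ((p^-1)%g i); rewrite ?mem_enum// permKV.
    by apply/mapP; exists i; rewrite ?mem_enum// perm1.
  by rewrite (perm_trans (H pi))// perm_sym.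
have D0 : 0 < D.
  have An0 : 0 < An.
    rewrite /An big_ord_recl; apply: ltr_pwDl => //.
    by apply: sumr_ge0 => i _; exact: ltW.
  have s0 : 0 <= \sum_(i < n.+1) a i ^+ 2 by apply: sumr_ge0 => i _; exact: sqr_ge0.
  apply: ltr_wpDl.
    by apply: mulr_ge0 => //; apply: mulr_ge0; [exact: sqr_ge0|exact: ltW].
  apply: mulr_gt0; last exact: exprn_gt0.
  by apply: mulr_gt0; [exact: exprn_gt0|lra].
have SE pi : prefsum (integ lam 0) (order_seq a pi) 0 = lbar * S pi.
  rewrite prefsum_ord /S mulr_sumr; apply: eq_bigr => i _.
  by rewrite add0r integZl// mulrCA.
have main pi pi' : lbar < (S pi' - S pi) / D ->
    (Mexp P N (order_seq a pi) 0 < Mexp P N (order_seq a pi') 0)%E.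
  rewrite ltr_pdivlMr// => h.
  apply: (Mexp_lt clam lam0 lamr NHPP) => //.
  - by move=> _ /mapP[i _ ->].
  rewrite !SE /len /sq (sumE id) (sumE (fun c => c ^+ 2)) -/An -mulrBr.
  (* A second factor [lbar] turns [lbar * D] into the quadratic error [(lbar * fplus) ^+ 2] times
     the budget, and [S] into [prefsum] for the rate [lam]. *)
  have := h; rewrite -(ltr_pM2l lbar0); apply: le_lt_trans.
  rewrite le_eqVlt; apply/predU1P; left; rewrite /D; ring.
split => [_ hyp pi ne|_ hyp pi ne]; first exact: main (hyp pi ne).
(* The LPT order is the one given by the reversal permutation, so [main] covers it too. *)
pose rv := perm (@rev_ord_inj n.+1).
have -> : [seq a (rev_ord i) | i <- enum 'I_n.+1] = order_seq a rv.
  by apply: eq_map => i; rewrite permE.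
have eS : S rv = \sum_(i < n.+1)
    a (rev_ord i) * F (\sum_(j < n.+1 | (rev_ord i <= j)%N) a j).
  apply: eq_bigr => i _; rewrite permE; congr (_ * F _).
  (* Reversing the summation index turns a prefix of the reversed order into a tail of [a]. *)
  rewrite /Apref [RHS](reindex_inj rev_ord_inj) /=.
  apply: eq_big => [j|j _]; last by rewrite permE.
  by rewrite leq_sub2lE// ?ltnS.
by apply: main; rewrite eS; exact: hyp.
Qed.
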